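(* Let $\mathbb{K}$ be any field. A one-dimensional simplicial complex $\Delta$ on $[n]=\{1,\dots,n\}$ satisfies $T^2(\Delta)=0$ if and only if the following three conditions hold: (i) every vertex in $\Delta$ has local degree at most three; (ii) every cycle in $\Delta$ is a dominating set; (iii) for every minimal nonface $\mathbf{b}$ of $\Delta$ with $\#\mathbf{b}=2$, the simplicial complex $\Delta\setminus\widehat{\mathbf{b}}$ is connected.
   Context: Here $n$ is a positive integer. A simplicial complex on $[n]$ is a family $\Delta\subseteq 2^{[n]}$ closed under taking subsets; it is one-dimensional if its largest faces have exactly two elements. A minimal nonface is a subset $C\subseteq[n]$ with $C\notin\Delta$ all of whose proper subsets are in $\Delta$. For $W\subseteq[n]$, $\Delta\setminus W:=\{F\in\Delta : F\cap W=\emptyset\}$. A simplicial complex is connected if its geometric realization is; the empty space counts as connected. The local degree of a vertex is the number of edges (2-element faces) incident to it. For $v\in[n]$, the neighborhood of $v$ is $\nu(v):=\{w\in[n] : \{v,w\}\in\Delta\}$; in particular $v\in\nu(v)$ whenever $\{v\}\in\Delta$. A subset $M\subseteq[n]$ is dominating if $\bigcup_{v\in M}\nu(v)=[n]$. A cycle in $\Delta$ is a sequence of $c\ge 3$ distinct vertices $(v_1,\dots,v_c)$ with $\{v_i,v_{i+1}\}\in\Delta$ for $i=1,\dots,c$, where $v_{c+1}=v_1$; it is identified with its vertex set when speaking of domination. For $\mathbf{b}\subseteq[n]$, $\widehat{\mathbf{b}}:=\mathbf{b}\cup\bigcap_{v\in\mathbf{b}}\nu(v)$. $T^2(\Delta)$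 is the second cotangent cohomology module of the Stanley-Reisner ring $S/I_\Delta$, where $S=\mathbb{K}[x_1,\dots,x_n]$ and $I=I_\Delta=\langle\prod_{i\in F}x_i : F\subseteq[n],\ F\notin\Delta\rangle$. Explicitly: let $m$ be the number of minimal monomial generators of $I$, let $d:S^m\to S$ be the $S$-linear map sending the canonical basis to these generators, $\operatorname{Syz}(I)=\ker d$, and $\operatorname{Kosz}(I)\subseteq\operatorname{Syz}(I)$ the submodule generated by all $d(f)g-d(g)f$ with $f,g\in S^m$. The quotient $\operatorname{Syz}(I)/\operatorname{Kosz}(I)$ is an $S/I$-module, and $T^2(\Delta)$ is the cokernel of the induced (restriction) map $\operatorname{Hom}_S(S^m,S/I)\to\operatorname{Hom}_{S/I}(\operatorname{Syz}(I)/\operatorname{Kosz}(I),S/I)$.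
   Formalization: The formal theorem additionally assumes that every element of [n] is a vertex of Δ; without this the claim fails, e.g. for n=4 and Δ the boundary of the triangle {1,2,3} with {4}∉Δ, where T²=0 but the cycle (1,2,3) is not dominating. *)

(* Defs.v *)
From HB Require Import structures.
From mathcomp Require Import all_boot all_order all_algebra.
From mathcomp Require Import boolp classical_sets functions reals topology.
(* The notations of mpoly clash with those of MathComp-Analysis. *)
From mathcomp Require Import -(notations) mpoly.

Set Implicit Arguments.
Unset Strict Implicit.
Unset Printing Implicit Defensive.

Import Order.TTheory GRing.Theory Num.Theory.
Import numFieldTopology.Exports.

Local Open Scope ring_scope.

Section Span.
Variables (R : nzRingType) (U : lmodType R).

(* Submodule generated by G, as the intersection of all submodules
   containing it. *)
Definition span (G : set U) : {pred U} := fun u =>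
  `[< forall M : {pred U}, submod_closed M ->
        (forall g, G g -> g \in M) -> u \in M >].

Lemma span_submod_closed (G : set U) : submod_closed (span G).
Proof.
split=> [|a u v /asboolP hu /asboolP hv]; apply/asboolP => M subM GM.
  by case: subM.
by case: (subM) => _; apply; [apply: hu | apply: hv].
Qed.

HB.instance Definition _ (G : set U) :=
  GRing.isSubmodClosed.Build R U (span G) (span_submod_closed G).

Lemma mem_span (G : set U) g : G g -> g \in span G.
Proof. by move=> Gg; apply/asboolP => M _; apply. Qed.

End Span.

Section QuotientModule.
Variables (R : nzRingType) (U : lmodType R) (P : submodClosed U).
Local Open Scope quotient_scope.

(* ring_quotient only quotients by a predicate known to be closed under
   opposite, which submodClosed does not record. *)
Definition quot_pred : {pred U} := P.

Fact quot_zmod_closed : zmod_closed quot_pred.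
Proof.
split=> [|u v Pu Pv]; first exact: (rpred0 P).
by rewrite -scaleN1r; apply: (rpredD (S := P)) => //; apply: (rpredZ (s := P)).
Qed.

HB.instance Definition _ :=
  GRing.isZmodClosed.Build U quot_pred quot_zmod_closed.

Definition quotmod := @Quotient.quot U quot_pred.
HB.instance Definition _ := EqQuotient.on quotmod.
HB.instance Definition _ := GRing.Zmodule.on quotmod.
HB.instance Definition _ := ZmodQuotient.on quotmod.
Local Notation Q := quotmod.

Definition quot_scale (a : R) (x : Q) : Q := \pi_Q (a *: repr x).

Lemma pi_quot_scale a u : quot_scale a (\pi_Q u) = \pi_Q (a *: u).
Proof.
apply/eqP; rewrite /quot_scale -Quotient.idealrBE -scalerBr.
apply: (rpredZ (s := P)).
have : repr (\pi_Q u) - u \in quot_pred by rewrite Quotient.idealrBE reprK.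
by [].
Qed.

Fact quot_scalerA a b x :
  quot_scale a (quot_scale b x) = quot_scale (a * b) x.
Proof. by elim/quotW: x => u; rewrite (pi_quot_scale b u) !pi_quot_scale scalerA. Qed.

Fact quot_scale1r : left_id 1 quot_scale.
Proof. by elim/quotW => u; rewrite pi_quot_scale scale1r. Qed.

Fact quot_scalerDr : right_distributive quot_scale +%R.
Proof.
move=> a; elim/quotW => u; elim/quotW => v.
by rewrite -(raddfD (\pi_Q)) 3!pi_quot_scale scalerDr (raddfD (\pi_Q)).
Qed.

Fact quot_scalerDl x : {morph quot_scale^~ x : a b / a + b}.
Proof.
by move=> a b; elim/quotW: x => u; rewrite 3!pi_quot_scale scalerDl (raddfD (\pi_Q)).
Qed.

HB.instance Definition _ := GRing.Zmodule_isLmodule.Build R Q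
  quot_scalerA quot_scale1r quot_scalerDr quot_scalerDl.

Fact pi_scalable : scalable (\pi_Q : U -> Q).
Proof. by move=> a u; rewrite -pi_quot_scale. Qed.

Lemma scale_pi a u : a *: (\pi_Q u) = \pi_Q (a *: u).
Proof. by rewrite pi_scalable. Qed.

HB.instance Definition _ := GRing.isScalable.Build R U Q _ \pi_Q pi_scalable.

Lemma pi_eq0 u : (\pi_Q u == 0 :> Q) = (u \in P).
Proof.
have -> : (u \in P) = (u - 0 \in quot_pred) by rewrite subr0.
by rewrite Quotient.idealrBE (raddf0 (\pi_Q)).
Qed.

End QuotientModule.


Section Hom.
Variables (R : comNzRingType) (U V : lmodType R).
Local Notation hom := {linear U -> V}.

Lemma hom_ext (f g : hom) : f =1 g -> f = g.
Proof.
case: f => f [[af] [sf]]; case: g => g [[ag] [sg]] /= /funext efg.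
by subst g; rewrite (Prop_irrelevance af ag) (Prop_irrelevance sf sg).
Qed.

HB.instance Definition _ := gen_eqMixin hom.
HB.instance Definition _ := gen_choiceMixin hom.

Definition hom_zero : hom := \0.
Definition hom_opp (f : hom) : hom := \- f.
Definition hom_add (f g : hom) : hom := f \+ g.
Definition hom_scale (a : R) (f : hom) : hom := a \*: f.

Fact hom_addA : associative hom_add.
Proof. by move=> f g h; apply: hom_ext => x /=; rewrite addrA. Qed.
Fact hom_addC : commutative hom_add.
Proof. by move=> f g; apply: hom_ext => x /=; rewrite addrC. Qed.
Fact hom_add0 : left_id hom_zero hom_add.
Proof. by move=> f; apply: hom_ext => x /=; rewrite add0r. Qed.
Fact hom_addN : left_inverse hom_zero hom_opp hom_add.
Proof. by move=> f; apply: hom_ext => x /=; rewrite addNr. Qed.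

HB.instance Definition _ :=
  GRing.isZmodule.Build hom hom_addA hom_addC hom_add0 hom_addN.

Fact hom_scaleA a b f : hom_scale a (hom_scale b f) = hom_scale (a * b) f.
Proof. by apply: hom_ext => x /=; rewrite scalerA. Qed.
Fact hom_scale1 : left_id 1 hom_scale.
Proof. by move=> f; apply: hom_ext => x /=; rewrite scale1r. Qed.
Fact hom_scaleDr : right_distributive hom_scale +%R.
Proof. by move=> a f g; apply: hom_ext => x /=; rewrite scalerDr. Qed.
Fact hom_scaleDl f : {morph hom_scale^~ f : a b / a + b}.
Proof. by move=> a b; apply: hom_ext => x /=; rewrite scalerDl. Qed.

HB.instance Definition _ := GRing.Zmodule_isLmodule.Build R hom
  hom_scaleA hom_scale1 hom_scaleDr hom_scaleDl.

End Hom.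

Section KernelCokernel.
Variables (R : nzRingType) (U V : lmodType R) (f : {linear U -> V}).

Definition ker_pred : {pred U} := fun u => f u == 0.

Fact ker_submod_closed : submod_closed ker_pred.
Proof.
split=> [|a u v]; rewrite !unfold_in ?linear0 // => /eqP fu /eqP fv.
by rewrite linearP fu fv scaler0 addr0.
Qed.

HB.instance Definition _ :=
  GRing.isSubmodClosed.Build R U ker_pred ker_submod_closed.

Record ker := Ker { ker_val : U; _ : ker_val \in ker_pred }.

HB.instance Definition _ := [isSub for ker_val].
HB.instance Definition _ := [Choice of ker by <:].
HB.instance Definition _ := [SubChoice_isSubLmodule of ker by <:].

Definition im_pred : {pred V} := fun v => `[< exists u, v = f u >].

Fact im_submod_closed : submod_closed im_pred.
Proof.
split=> [|a _ _ /asboolP[u ->] /asboolP[v ->]]; apply/asboolP.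
  by exists 0; rewrite linear0.
by exists (a *: u + v); rewrite linearP.
Qed.

HB.instance Definition _ :=
  GRing.isSubmodClosed.Build R V im_pred im_submod_closed.

Definition coker := quotmod im_pred.

HB.instance Definition _ := GRing.Lmodule.on coker.

End KernelCokernel.

Section Lift.
Variables (R : nzRingType) (U V : lmodType R).

Lemma span_ker (f : {linear U -> V}) (G : set U) :
  (forall g, G g -> f g = 0) -> forall u, u \in span G -> f u = 0.
Proof.
move=> fG u /asboolP/(_ (ker_pred f) (ker_submod_closed f)) ku.
by apply/eqP; apply: ku => g /fG/eqP.
Qed.

Variables (P : submodClosed U) (f : {linear U -> V}).
Hypothesis fP : forall u, u \in P -> f u = 0.

(* The map induced by f on the quotient by P. *)
Definition quot_lift_fun (x : quotmod P) : V := f (repr x).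

Fact quot_lift_fun_pi u : quot_lift_fun (\pi_(quotmod P)%qT u) = f u.
Proof.
apply/eqP; rewrite -subr_eq0 -raddfB; apply/eqP/fP.
rewrite -pi_eq0 (raddfB (\pi_(quotmod P)%qT)) subr_eq0.
by apply/eqP; exact: reprK.
Qed.

Fact quot_lift_linear : linear quot_lift_fun.
Proof.
move=> a; elim/quotW => u; elim/quotW => v.
by rewrite -(linearP (\pi_(quotmod P)%qT)) !quot_lift_fun_pi linearP.
Qed.

Definition quot_lift : {linear quotmod P -> V} :=
  HB.pack quot_lift_fun
    (GRing.isLinear.Build R (quotmod P) V _ quot_lift_fun quot_lift_linear).

Lemma quot_lift_pi u : quot_lift (\pi_(quotmod P)%qT u) = f u.
Proof. exact: quot_lift_fun_pi. Qed.

End Lift.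

Section CotangentT2.
Variables (S : comNzRingType) (I : submodClosed S^o).
Variables (J : finType) (g : J -> S).
Hypothesis gI : forall j, g j \in I.

Definition free_mod := {ffun J -> S^o}.
HB.instance Definition _ := GRing.Lmodule.on free_mod.

Definition gen_map (f : free_mod) : S^o := \sum_j f j * g j.

Lemma gen_mapE f : gen_map f = \sum_j f j * g j.
Proof. by []. Qed.

Fact gen_map_linear : linear gen_map.
Proof.
move=> a f h; rewrite scaler_sumr -big_split; apply: eq_bigr => j _ /=.
by rewrite !ffunE mulrDl scalerAl.
Qed.

HB.instance Definition _ :=
  GRing.isLinear.Build S free_mod S^o _ gen_map gen_map_linear.

Definition Syz := ker gen_map.
HB.instance Definition _ := GRing.Lmodule.on Syz.

Definition Kosz : {pred Syz} :=
  span (fun s : Syz => exists f h : free_mod,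
          val s = (gen_map f : S) *: h - (gen_map h : S) *: f).
HB.instance Definition _ := GRing.SubmodClosed.on Kosz.

Lemma gen_map_ideal f : gen_map f \in I.
Proof. by apply: rpred_sum => j _; apply: (@rpredZ _ _ I (f j)). Qed.

Lemma ideal_kills_quot (a : S) (x : quotmod I) : a \in I -> a *: x = 0.
Proof.
elim/quotW: x => u aI; rewrite scale_pi; apply/eqP; rewrite pi_eq0.
by rewrite /GRing.scale /= mulrC; apply: (@rpredZ _ _ I u).
Qed.

Lemma Kosz_kills (h : {linear free_mod -> quotmod I}) (s : Syz) :
  s \in Kosz -> h (val s) = 0.
Proof.
apply: (span_ker (f := h \o val)) => {}s [f1 [f2 Es]].
rewrite /= Es linearB !linearZ /=.
by rewrite !ideal_kills_quot ?addr0 //; apply: gen_map_ideal.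
Qed.

(* I annihilates quotmod I (ideal_kills_quot), and it annihilates
   quotmod Kosz when it is generated by g (ideal_kills_syz), so that the
   S/I-linear maps from quotmod Kosz to quotmod I are the S-linear ones. *)
Definition hom_gens := {linear free_mod -> quotmod I}.
HB.instance Definition _ := GRing.Lmodule.on hom_gens.

Definition hom_syz := {linear quotmod Kosz -> quotmod I}.
HB.instance Definition _ := GRing.Lmodule.on hom_syz.

Definition restriction (h : hom_gens) : hom_syz :=
  @quot_lift _ _ _ Kosz (h \o val) (Kosz_kills h).

Lemma restriction_pi h (s : Syz) :
  restriction h (\pi_(quotmod Kosz)%qT s) = h (val s).
Proof. exact: quot_lift_pi. Qed.

Fact restriction_linear : linear restriction.
Proof. by move=> a h k; apply: hom_ext. Qed.

HB.instance Definition _ :=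
  GRing.isLinear.Build S hom_gens hom_syz _ restriction restriction_linear.

Definition T2 := coker restriction.
HB.instance Definition _ := GRing.Lmodule.on T2.

Lemma ideal_kills_syz (a : S) (x : quotmod Kosz) :
  (exists f, a = gen_map f) -> a *: x = 0.
Proof.
case=> f ->; elim/quotW: x => s; rewrite scale_pi; apply/eqP; rewrite pi_eq0.
apply: mem_span; exists f, (val s); rewrite linearZ /=.
have /eqP -> : gen_map (ker_val s) == 0 by exact: (valP s).
by rewrite scale0r subr0.
Qed.

End CotangentT2.

Section Complex.
Variable n : nat.
Implicit Types (D : {set {set 'I_n}}) (C F W b M : {set 'I_n}).

Definition simplicial_complex D :=
  forall F G : {set 'I_n}, F \in D -> G \subset F -> G \in D.

Definition one_dimensional D := (\max_(F in D) #|F|)%N = 2%N.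

Definition min_nonface D C :=
  (C \notin D) && [forall F : {set 'I_n}, (F \proper C) ==> (F \in D)].

Definition deletion D W := [set F in D | [disjoint F & W]].

Definition local_degree D (v : 'I_n) :=
  #|[set F in D | (#|F| == 2)%N && (v \in F)]|.

Definition nbhd D (v : 'I_n) := [set w | [set v; w] \in D].

Definition dominating D M := \bigcup_(v in M) nbhd D v = [set: 'I_n].

Definition is_cycle D (s : seq 'I_n) :=
  [&& (2 < size s)%N, uniq s & cycle (fun v w => [set v; w] \in D) s].

Definition hat D b := b :|: \bigcap_(v in b) nbhd D v.

(* A point of the realization is given by its barycentric coordinates. *)
Definition realization (R : realType) D : set 'rV[R]_n :=
  fun x => [/\ forall i, 0 <= x ord0 i, \sum_i x ord0 i = 1
             & [set i | x ord0 i != 0]%SET \in D].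
Arguments realization R D : clear implicits.

Definition complex_connected (R : realType) D := connected (realization R D).

End Complex.

Section StanleyReisner.
Variables (K : fieldType) (n : nat) (D : {set {set 'I_n}}).
Local Notation S := (mpoly n K).

Definition sqfree_mon (F : {set 'I_n}) : S :=
  \prod_(i in F) mpolyX K (mnm1 i).

Definition SR_ideal : {pred S^o} :=
  span (fun p : S^o => exists2 F, F \notin D & p = sqfree_mon F).
HB.instance Definition _ := GRing.SubmodClosed.on SR_ideal.

Definition mingen_index := {C : {set 'I_n} | min_nonface D C}.

Definition mingen (C : mingen_index) : S := sqfree_mon (val C).

Lemma mingen_SR_ideal C : mingen C \in SR_ideal.
Proof. by apply: mem_span; exists (val C) => //; case/andP: (valP C). Qed.

Definition SR_T2 := T2 mingen_SR_ideal.
HB.instance Definition _ := GRing.Lmodule.on SR_T2.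

Definition T2_vanishes := forall t : SR_T2, t = 0.

Lemma SR_ideal_gen_map (p : S) :
  p \in SR_ideal -> exists f, p = gen_map mingen f.
Proof.
move=> /asboolP/(_ (im_pred (gen_map mingen)) (im_submod_closed _)) hp.
apply/asboolP; apply: hp => {p} _ [F FD ->]; apply/asboolP.
have [C minC sCF] := minset_exists (P := fun C => C \notin D) FD.
have mC : min_nonface D C.
  case/minsetP: minC => CD minC; rewrite /min_nonface CD; apply/forallP => G.
  apply/implyP => /properP[sGC [x Cx Gx]]; apply: contraNT Gx => GD.
  by rewrite (minC G).
pose C0 : mingen_index := exist _ C mC.
pose f : free_mod S mingen_index :=
  [ffun C' => if val C' == C then sqfree_mon (F :\: C) : S^o else 0].
exists f; rewrite -[RHS]/(gen_map mingen f) gen_mapE (bigD1 C0) //=.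
rewrite ffunE eqxx big1 => [|C' neC].
  rewrite addr0 /mingen /= /sqfree_mon (finset.big_setID C) /=.
  by rewrite (finset.setIidPr sCF) mulrC.
by rewrite ffunE ifN ?mul0r //; apply: contraNneq neC => eC.
Qed.

Let supp (m : multinom n) : {set 'I_n} := [set i | m i != 0%N].
Let ind (F : {set 'I_n}) : multinom n :=
  Multinom [tuple (i \in F : nat) | i < n].

Lemma indE F i : ind F i = (i \in F).
Proof. by rewrite mnmE. Qed.

Lemma sqfree_monE F : sqfree_mon F = mpolyX K (ind F).
Proof.
rewrite /sqfree_mon mprodXE; congr mpolyX; apply/mnmP => i.
rewrite mnm_sumE indE big_mkcond (bigD1 i) //= mnm1E eqxx big1 ?addn0.
  by case: (i \in F).
by move=> j /negPf ji; rewrite mnm1E ji if_same.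
Qed.

Lemma mpolyX_SR_ideal m : mpolyX K m \in SR_ideal <->
  exists2 F : {set 'I_n}, F \notin D & F \subset supp m.
Proof.
split=> [|[F FD sF]]; last first.
  have -> : m = mnm_add (mnm_sub m (ind F)) (ind F).
    rewrite submK //; apply/mnm_lepP => i; rewrite indE.
    by case: (boolP (i \in F)) => // /(fintype.subsetP sF); rewrite inE lt0n.
  rewrite mpolyXD -sqfree_monE.
  by apply: (@rpredZ _ _ SR_ideal); apply: mem_span; exists F.
pose inJ m := [exists F : {set 'I_n}, (F \notin D) && (F \subset supp m)].
pose M : {pred S^o} := fun p => all inJ (msupp p).
move=> /asboolP/(_ M) hM.
have {hM} : mpolyX K m \in M.
  apply: hM.
    split=> [|a u v /allP Mu /allP Mv]; first by rewrite unfold_in msupp0.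
    apply/allP => k /msuppD_le; rewrite mem_cat => /orP[|/Mv //].
    move=> /msuppM_le/allpairsP[[k1 k2] /= [_ /Mu/existsP[F /andP[FD sF]] ->]].
    apply/existsP; exists F; rewrite FD; apply/fintype.subsetP => i /(fintype.subsetP sF).
    by rewrite !inE mnmDE addn_eq0 negb_and orbC => ->.
  move=> _ [F FD ->]; apply/allP => k; rewrite sqfree_monE msuppX inE => /eqP ->.
  apply/existsP; exists F; rewrite FD; apply/fintype.subsetP => i Fi.
  by rewrite inE indE Fi.
rewrite unfold_in msuppX /= andbT => /existsP[F /andP[FD sF]].
by exists F.
Qed.

Lemma mingenP m :
  (mpolyX K m \in SR_ideal /\
   forall m', mpolyX K m' \in SR_ideal -> lem m' m -> m' = m) <->
  exists C, mpolyX K m = mingen C.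
Proof.
have supp_ind (F : {set 'I_n}) : supp (ind F) = F.
  by apply/finset.setP => i; rewrite inE indE; case: (i \in F).
have ind_le (F : {set 'I_n}) k : F \subset supp k -> lem (ind F) k.
  move=> sF; apply/mnm_lepP => i; rewrite indE.
  by case: (boolP (i \in F)) => // /(fintype.subsetP sF); rewrite inE lt0n.
split=> [[/mpolyX_SR_ideal[F FD sF] minm]|[C]].
  have indm (G : {set 'I_n}) : G \notin D -> G \subset F -> ind G = m.
    move=> GD sG; apply: minm; last by apply/ind_le/(fintype.subset_trans sG).
    by apply/mpolyX_SR_ideal; exists G; rewrite ?supp_ind.
  have mF : min_nonface D F.
    rewrite /min_nonface FD; apply/forallP => G; apply/implyP => pG.
    apply: contraLR pG => GD; rewrite properE negb_and negbK.
    case: (boolP (G \subset F)) => //= sG.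
    by rewrite -[F]supp_ind (indm F) // -(indm G) // supp_ind fintype.subxx.
  by exists (exist _ F mF); rewrite /mingen sqfree_monE indm.
rewrite /mingen sqfree_monE; case: C => C mC /= /(congr1 (@msupp _ _)).
rewrite !msuppX => -[->]; case/andP: mC => CD /forallP mC.
split=> [|k /mpolyX_SR_ideal[F FD sF] lek].
  by apply/mpolyX_SR_ideal; exists C; rewrite ?supp_ind.
have sFC : F \subset C.
  apply/fintype.subsetP => i /(fintype.subsetP sF); rewrite inE => ki.
  have := mnm_lepP lek i; rewrite indE; case: (i \in C) => //.
  by rewrite leqn0 (negPf ki).
have eFC : F = C.
  apply/eqP; rewrite finset.eqEsubset sFC; apply: contraNT FD => nCF.
  by apply: (implyP (mC F)); rewrite properE sFC.
apply/mnmP => i; apply/eqP; rewrite eqn_leq (mnm_lepP lek) /=.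
by rewrite -eFC; apply: (mnm_lepP (ind_le _ _ sF)).
Qed.

End StanleyReisner.

(* Main.v *)
(** Hom(Syz/Kosz, S/I) and T^2 are graded by Z^n. In degree a - b (with disjoint supports,
    b squarefree; only the support of a matters), a homomorphism is the same as a relative
    1-cocycle: for each face F containing a and disjoint from b, a function nu F on the
    minimal nonfaces C inside the union of F and b, determined up to a constant that is
    fixed as soon as some C does not contain b; it extends to the free module exactly when
    these functions can be shifted by constants so as to agree on common nonfaces.

    For a graph, only five kinds of degrees can carry a nontrivial class.
    - a a vertex, b two of its neighbors: obstructed when the vertex has degree at least 4.
    - a empty, b an edge: not obstructed once all degrees are at most 3.
    - a empty, b a vertex x: the shifts form a potential for edge weights on the graph
      induced on the vertices outside the neighborhood of x; it exists for all weights if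
      and only if this graph is a forest, that is, if every cycle dominates x.
    - a empty, b a nonedge: this is the connectedness of the deletion of the hat of b, up to
      edges joining two common neighbors, which (i) and (ii) control.
    - a empty, b a 3-cycle: this asks that the deletion of b be connected, which follows
      from (i), (ii) and (iii) for suitable nonedges. *)
From HB Require Import structures.
Require Import Defs.
From mathcomp Require Import all_boot all_order all_algebra.
From mathcomp Require Import boolp classical_sets functions reals topology.
From mathcomp Require Import normedtype zify.
From mathcomp Require Import -(notations) mpoly.

Set Implicit Arguments.
Unset Strict Implicit.
Unset Printing Implicit Defensive.

Import Order.TTheory GRing.Theory Num.Theory.
Import numFieldNormedType.Exports.

Local Open Scope ring_scope.

(** * Graphs and weights *)

(** The normalization expresses that exponents cannot be negative: a map of degree a - b on the free
    module sends the basis vector of C to a multiple of x^(C + a - b), which is a monomial only if b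
    lies in C, so every other C gets the constant 0. Cocycles are taken only up to a constant on
    each face because the coefficients of a syzygy sum to zero in every degree, so a constant common
    to all generators inside F and b is invisible.

    No grading of Hom is constructed. A cocycle is turned into a homomorphism coefficient by
    coefficient; conversely, the extension problem for a given homomorphism is solved in each degree
    separately. The obstacle is then finiteness: solutions in infinitely many degrees must assemble
    into polynomials. This works because the syzygies between two generators at their lcm generate
    all syzygies, and there are finitely many of them.

    Necessity of the conditions is tested on cochains with values 0 and 1, and sufficiency holds for
    values in any abelian group; hence the result over every field. *)

(** Induction on the number of edges, counted as ordered pairs: removing an edge of a forest
    separates its endpoints, so a potential for the remaining edges can be corrected on one side. *)
Lemma acyclic_potential (T : finType) (V : zmodType) (e : rel T)
    (w : T -> T -> V) :
  ssrbool.symmetric e -> irreflexive e ->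
  (forall u v, e u v -> w v u = - w u v) ->
  (forall s, (2 < size s)%N -> uniq s -> ~~ cycle e s) ->
  exists p : T -> V, forall u v, e u v -> p u - p v = w u v.
Proof.
move: {2}#|_| (leqnn #|[pred z : T * T | e z.1 z.2]|) => k.
elim: k e => [|k IH] e le_k sym_e irr_e anti_w acyc.
  exists (fun=> 0) => u v euv; move: le_k; rewrite leqn0 => /eqP/card0_eq.
  by move/(_ (u, v)); rewrite inE /= euv.
case: (pickP [pred z : T * T | e z.1 z.2]) => [[x y] /= exy | noe]; last first.
  by exists (fun=> 0) => u v euv; move: (noe (u, v)); rewrite /= euv.
pose e' : rel T := fun u v =>
  e u v && ~~ ((u == x) && (v == y) || (u == y) && (v == x)).
have sub_e : subrel e' e by move=> u v /andP[].
have sym_e' : ssrbool.symmetric e'.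
  by move=> u v; rewrite /e' sym_e orbC (andbC (u == y)) (andbC (u == x)).
have [|||||p Hp] := IH e'.
- rewrite -ltnS; apply: leq_trans le_k; apply: proper_card.
  apply/properP; split; first by apply/fintype.subsetP => -[u v]; apply: sub_e.
  by exists (x, y); rewrite !inE //= /e' !eqxx /= andbF.
- by [].
- by move=> u; rewrite /e' irr_e.
- by move=> u v /sub_e; apply: anti_w.
- move=> s s2 us; apply: contra (acyc s s2 us).
  by apply: sub_cycle.
(* A path without repetition from [x] to [y] would close up to a cycle through the removed edge.
   Lengths 0 and 1 are impossible, because [x] and [y] differ and their edge is gone. *)
have nxy : ~~ connect e' x y.
  apply/negP => /connectP[q pq ey]; case/shortenP: pq ey => q' pq' uq' _ ey.
  have := acyc (x :: q').
  case: q' ey pq' uq' => [|z q'] /= ey.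
    by move: exy; rewrite ey irr_e.
  case: q' ey => [|z' q'] /= ey.
    by rewrite -ey /e' !eqxx /= andbF.
  move=> /and3P[e1 e2 e3] uq /(_ isT uq)/negP; apply; rewrite rcons_path.
  by rewrite (sub_e _ _ e1) (sub_e _ _ e2) (sub_path sub_e e3) -ey sym_e.
pose c := w x y - (p x - p y).
have jump : p x + c - (p y + 0) = w x y.
  by rewrite addr0 addrAC addrC subrK.
(* Adding [c] on the whole component of [x] repairs the removed edge and keeps all other
   differences. *)
exists (fun z => p z + (if connect e' x z then c else 0)) => u v euv.
have [/andP[/eqP-> /eqP->]|nxy1] := boolP ((u == x) && (v == y)).
  by rewrite connect0 (negPf nxy).
have [/andP[/eqP-> /eqP->]|nxy2] := boolP ((u == y) && (v == x)).
  by rewrite connect0 (negPf nxy) -opprB jump (anti_w _ _ exy).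
have e'uv : e' u v by rewrite /e' euv (negPf nxy1) (negPf nxy2).
have -> : connect e' x u = connect e' x v.
  by apply: (same_connect_r (sym_connect_sym sym_e')); apply: connect1.
by rewrite opprD addrACA subrr addr0 Hp.
Qed.

(** * One-dimensional complexes as graphs *)

Section Graph.
Variables (n : nat) (D : {set {set 'I_n}}).
Hypothesis simplD : simplicial_complex D.
Hypothesis vertD : forall v : 'I_n, [set v] \in D.
Hypothesis dimD : one_dimensional D.
Implicit Types (u v w x y z : 'I_n) (a b C F : {set 'I_n}).

Definition adj u v := (u != v) && ([set u; v] \in D).

Lemma adjC u v : adj u v = adj v u.
Proof. by rewrite /adj eq_sym finset.setUC. Qed.

Lemma adj_irrefl u : adj u u = false.
Proof. by rewrite /adj eqxx. Qed.

Lemma adj_neq u v : adj u v -> u != v.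
Proof. by case/andP. Qed.

Lemma mem_nbhd u v : (v \in nbhd D u) = (u == v) || adj u v.
Proof.
rewrite inE /adj; case: eqVneq => //= ->; rewrite finset.setUid; exact: vertD.
Qed.

Lemma card_face F : F \in D -> (#|F| <= 2)%N.
Proof. by move=> FD; rewrite -[2%N]dimD; exact: (@leq_bigmax_cond _ (mem D) (fun F => #|F|) F FD). Qed.

Lemma nonface_card3 F : (2 < #|F|)%N -> F \notin D.
Proof. by move=> F2; apply/negP => /card_face; rewrite leqNgt F2. Qed.

Lemma local_degreeE v : local_degree D v = #|[set w | adj v w]|.
Proof.
rewrite /local_degree -(card_in_imset (f := fun w => [set v; w])).
  apply: eq_card => F; rewrite !inE.
  apply/andP/imsetP => [[FD /andP[/cards2P[x [y [nxy eF]]] vF]] | [w]].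
    move: FD vF; rewrite eF !inE => FD /orP[] /eqP ev; subst v.
      by exists y; rewrite // inE /adj nxy.
    by exists x; rewrite 1?finset.setUC // inE /adj eq_sym nxy finset.setUC.
  rewrite inE => /andP[nvw vwD] ->; split=> //.
  by rewrite cards2 nvw !inE eqxx.
move=> u w; rewrite !inE => /andP[nvu _] /andP[nvw _] /finset.setP/(_ u).
by rewrite !inE eqxx orbT eq_sym (negPf nvu) /= => /esym/eqP.
Qed.

(** The form in which condition (i) is used: three known neighbors exhaust the neighborhood. *)
Lemma degree_le3 v x y z w : (local_degree D v <= 3)%N ->
  uniq [:: x; y; z] -> adj v x -> adj v y -> adj v z -> adj v w ->
  w \in [:: x; y; z].
Proof.
move=> deg3 uq vx vy vz vw; apply: contraLR deg3 => nw; rewrite -ltnNge.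
rewrite local_degreeE; apply: (@leq_trans #|[set p in [:: w; x; y; z]]|).
  by rewrite cardsE (card_uniqP _) //= nw.
apply/subset_leq_card/fintype.subsetP => p; rewrite !inE.
by case/or4P => /eqP->.
Qed.

Lemma min_nonface_exists F : F \notin D -> exists2 C, min_nonface D C & C \subset F.
Proof.
move=> FD; have [C minC sCF] := minset_exists (P := fun C => C \notin D) FD.
exists C => //; case/minsetP: minC => CD minC; rewrite /min_nonface CD.
apply/forallP => G; apply/implyP => /properP[sGC [x Cx Gx]].
by apply: contraNT Gx => GD; rewrite (minC G).
Qed.

Lemma min_nonface_inj b C : min_nonface D b -> min_nonface D C -> b \subset C -> C = b.
Proof.
move=> /andP[bD _] /andP[_ /forallP/(_ b)]; rewrite finset.properEneq (negPf bD).
by case: eqVneq => //= _; case: (_ \subset _).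
Qed.

Lemma min_nonface2 u v : u != v -> ~~ adj u v -> min_nonface D [set u; v].
Proof.
move=> nuv; rewrite /adj nuv /min_nonface => ->; apply/forallP => F.
apply/implyP => /properP[/fintype.subsetP sF [w]].
rewrite !inE => /orP[]/eqP-> nF; [apply: (simplD (vertD v)) | apply: (simplD (vertD u))];
  apply/fintype.subsetP => z Fz; move: (sF z Fz); rewrite !inE => /orP[]// /eqP ez;
  by rewrite -ez Fz in nF.
Qed.

Lemma min_nonface2P b : min_nonface D b -> #|b| = 2%N ->
  exists x y, [/\ x != y, b = [set x; y] & ~~ adj x y].
Proof.
move=> /andP[bD _] /eqP/cards2P[x [y [nxy eb]]]; exists x, y; split=> //.
by rewrite /adj nxy -eb.
Qed.

Lemma faceP F : F \in D ->
  [\/ F = finset.set0, exists v, F = [set v] | exists u v, adj u v /\ F = [set u; v]].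
Proof.
move=> FD; have := card_face FD; case E: #|F| => [|[|[|//]]] _.
- by constructor 1; apply/eqP; rewrite -cards_eq0 E.
- by constructor 2; apply/cards1P; rewrite E.
- constructor 3; move/eqP/cards2P: E => [x [y [nxy eF]]].
  by exists x, y; rewrite /adj nxy -eF.
Qed.

Definition faces_over a b := [set F in D | (a \subset F) && [disjoint F & b]].
Definition gens_in b F := [set C | min_nonface D C & C \subset F :|: b].

Lemma faces_overP a b F :
  reflect [/\ F \in D, a \subset F & forall z, z \in F -> z \notin b]
          (F \in faces_over a b).
Proof.
rewrite inE disjoint_subset; apply: (iffP and3P).
  by case=> FD aF /fintype.subsetP dF; split=> // z /dF; rewrite inE.
by case=> FD aF dF; split=> //; apply/fintype.subsetP => z /dF; rewrite inE.
Qed.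

Lemma gens_inP b F C :
  reflect (min_nonface D C /\ C \subset F :|: b) (C \in gens_in b F).
Proof. by rewrite inE; apply: andP. Qed.

Lemma gens_inS b F (G : {set 'I_n}) C : F \subset G -> C \in gens_in b F -> C \in gens_in b G.
Proof.
move=> FG /gens_inP[mC sC]; apply/gens_inP; split=> //.
by apply: fintype.subset_trans sC _; apply: finset.setSU.
Qed.

(** * Graded cocycles and coboundaries *)

Section Cochains.
Variable K : zmodType.
Implicit Types nu : {set 'I_n} -> {set 'I_n} -> K.

(* The degree a - b part of T^2 is the first cohomology of the poset of the faces F of
   faces_over a b with F :|: b a nonface, relative to those for which already a proper
   subset of b, joined to F, is a nonface (Altmann and Christophersen). Here nu F C is the
   value of a cochain at the generator C of the simplex of generators inside F :|: b. *)
Definition cocycle_over a b nu :=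
  (forall F C, F \in faces_over a b -> C \in gens_in b F -> ~~ (b \subset C) ->
     nu F C = 0) /\
  (forall (F G C C' : {set 'I_n}), F \in faces_over a b -> G \in faces_over a b ->
     F \subset G -> C \in gens_in b F -> C' \in gens_in b F ->
     nu F C - nu F C' = nu G C - nu G C').

Definition coboundary_over a b nu := exists mu : {set 'I_n} -> K,
  (forall C, ~~ (b \subset C) -> mu C = 0) /\
  (forall F (C C' : {set 'I_n}), F \in faces_over a b -> C \in gens_in b F ->
     C' \in gens_in b F -> nu F C - nu F C' = mu C - mu C').

Definition H1_trivial a b := forall nu, cocycle_over a b nu -> coboundary_over a b nu.

End Cochains.

Lemma nonface_gen b F (G : {set 'I_n}) : G \notin D -> G \subset F :|: b ->
  exists2 C, C \in gens_in b F & C \subset G.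
Proof.
move=> /min_nonface_exists[C mC sC] sG; exists C => //; apply/gens_inP; split=> //.
exact: fintype.subset_trans sC sG.
Qed.

Lemma triple_nonface x y z : uniq [:: x; y; z] -> [set x; y; z] \notin D.
Proof.
move=> u; apply: nonface_card3.
have -> : [set x; y; z] = [set p in [:: x; y; z]].
  by apply/finset.setP => p; rewrite !inE orbA.
by rewrite cardsE (card_uniqP u).
Qed.

(** A nonface inside the union of [F] and [b] that missed some [z] of [b] would lie in the face
    [F :|: (b :\ z)]. *)
Lemma gen_supset b F C : C \in gens_in b F ->
  (forall z, z \in b -> F :|: (b :\ z) \in D) -> b \subset C.
Proof.
move=> /gens_inP[/andP[CD _] sC] h; apply/fintype.subsetP => z zb.
apply: contraNT CD => nzC; apply: simplD (h z zb) _.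
apply/fintype.subsetP => w wC; have := fintype.subsetP sC w wC.
rewrite !inE => /orP[->//|->]; rewrite andbT orbC; case: eqVneq => // ew.
by rewrite -ew wC in nzC.
Qed.

Lemma pairD1l x y : x != y -> [set x; y] :\ x = [set y].
Proof.
move=> nxy; apply/finset.setP => z; rewrite !inE.
by case: (eqVneq z x) => [->|] //=; rewrite (negPf nxy).
Qed.

Lemma pairD1r x y : x != y -> [set x; y] :\ y = [set x].
Proof. by rewrite eq_sym finset.setUC; apply: pairD1l. Qed.

Lemma pair_subset (F : {set 'I_n}) u v : u \in F -> v \in F -> [set u; v] \subset F.
Proof.
by move=> uF vF; apply/fintype.subsetP => z; rewrite !inE => /orP[]/eqP->.
Qed.

(** * Necessity of the three conditions *)

(** Among four neighbors x, y, v, w of [u], take a = {u} and b = {x, y}. A cochain supported on the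
    edge uv is a cocycle, since all generators of the face {u} contain b. The edges uv and uw are
    both normalized, so each forces its own value, 1 and 0, on a common generator [C0]. *)
Lemma H1_degree (K : fieldType) u :
  (forall a b, H1_trivial K a b) -> (local_degree D u <= 3)%N.
Proof.
move=> H1; rewrite leqNgt local_degreeE; apply/negP.
rewrite cardE => sz; have ue := enum_uniq [set w | adj u w].
have memN p : p \in enum [set w | adj u w] -> adj u p by rewrite mem_enum inE.
move: sz ue memN; case: (enum _) => [|x [|y [|v [|w s]]]] // _ ue memN.
have {}ue : uniq [:: x; y; v; w].
  by move: ue; rewrite -[_ :: _]/([:: x; y; v; w] ++ s) cat_uniq => /andP[].
have [ux uy uv uw] : [/\ adj u x, adj u y, adj u v & adj u w].
  by split; apply: memN; rewrite !inE eqxx ?orbT.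
move: ue {memN}; rewrite /= !inE !negb_or !andbT -!andbA.
move=> /and5P[nxy nxv nxw nyv /andP[nyw nvw]].
have [nux nuy nuv nuw] := And4 (adj_neq ux) (adj_neq uy) (adj_neq uv) (adj_neq uw).
pose a := [set u]; pose b := [set x; y].
pose nu F C : K := if (F == [set u; v]) && (b \subset C) then 1 else 0.
have subb C : C \in gens_in b a -> b \subset C.
  move=> /gen_supset; apply=> z; rewrite !inE => /orP[]/eqP->.
    by rewrite pairD1l //; case/andP: uy.
  by rewrite pairD1r //; case/andP: ux.
have over p : p != x -> p != y -> adj u p -> [set u; p] \in faces_over a b.
  move=> npx npy up; apply/faces_overP; split; first by case/andP: up.
    by rewrite finset.sub1set !inE eqxx.
  by move=> z; rewrite !inE => /orP[]/eqP->; rewrite negb_or ?npx ?npy // nux nuy.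
have [|mu [mu0 Hmu]] := H1 a b nu.
  split=> [F C _ _ /negPf nb | F G C C' /faces_overP[FD aF _] /faces_overP[GD _ _] FG gC gC'].
    by rewrite /nu nb andbF.
  have [->//|nFG] := eqVneq F G.
  have eF : F = a.
    apply/esym/eqP; rewrite finset.eqEcard aF cards1 -ltnS.
    apply: leq_trans (card_face GD); apply: proper_card.
    by rewrite finset.properEneq nFG.
  by subst F; rewrite /nu !subb // !subrr.
have [C0 gC0 _] : exists2 C, C \in gens_in b a & C \subset [set u; x; y].
  apply: nonface_gen; first by apply: triple_nonface; rewrite /= !inE negb_or nux nuy nxy.
  by rewrite finset.setUA.
have bC0 := subb _ gC0.
(* The nonface {u, p, x} contains a generator that misses y; there both [mu] and [nu] vanish, which
   removes the freedom of a constant. *)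
have key p : p != x -> p != y -> adj u p -> nu [set u; p] C0 = mu C0.
  move=> npx npy up; have oF := over _ npx npy up.
  have [C1 gC1 sC1] : exists2 C, C \in gens_in b [set u; p] & C \subset [set u; p; x].
    apply: nonface_gen.
      by apply: triple_nonface; rewrite /= !inE negb_or nux npx (adj_neq up).
    by apply: finset.setUS; rewrite finset.sub1set !inE eqxx.
  have nbC1 : ~~ (b \subset C1).
    apply/negP => /fintype.subsetP/(_ y); rewrite !inE eqxx orbT => /(_ isT).
    move/(fintype.subsetP sC1); rewrite !inE ![y == _]eq_sym.
    by rewrite (negPf nuy) (negPf npy) (negPf nxy).
  have gC0' : C0 \in gens_in b [set u; p].
    by apply: gens_inS gC0; rewrite finset.sub1set !inE eqxx.
  have := Hmu _ _ _ oF gC0' gC1; rewrite (mu0 _ nbC1) subr0 => <-.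
  by rewrite /nu (negPf nbC1) andbF subr0.
have e1 : mu C0 = 1 by rewrite -(key v) ?[v == _]eq_sym // /nu eqxx bC0.
have e0 : mu C0 = 0.
  rewrite -(key w) ?[w == _]eq_sym // /nu; case: eqP => // /finset.setP/(_ w).
  by rewrite !inE eqxx orbT eq_sym (negPf nuw) eq_sym (negPf nvw).
by move: (oner_neq0 K); rewrite -e1 e0 eqxx.
Qed.

(** Two-valued functions constant along edges match both clopen subsets of the realization and test
    cochains, so that paths never enter. *)
Definition graph_connected (E : {set {set 'I_n}}) := forall g : 'I_n -> bool,
  (forall u v, [set u; v] \in E -> g u = g v) ->
  forall u v, [set u] \in E -> [set v] \in E -> g u = g v.

Lemma deletion1 (W : {set 'I_n}) u : ([set u] \in deletion D W) = (u \notin W).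
Proof. by rewrite inE vertD finset.disjoints1. Qed.

Lemma deletion2 (W : {set 'I_n}) u v :
  ([set u; v] \in deletion D W) = [&& [set u; v] \in D, u \notin W & v \notin W].
Proof.
by rewrite inE finset.disjoints_subset finset.subUset !finset.sub1set !inE.
Qed.

Lemma mem_hat2 x y z : z \in hat D [set x; y] =
  [|| z == x, z == y | adj x z && adj y z].
Proof.
rewrite !inE; case: (eqVneq z x) => //= zx; case: (eqVneq z y) => //= zy.
apply/finset.bigcapP/andP => [h | [xz yz] w].
  have := h x; have := h y; rewrite !mem_nbhd !inE !eqxx orbT.
  by rewrite ![_ == z]eq_sym (negPf zx) (negPf zy) => /(_ isT) ? /(_ isT).
by rewrite mem_nbhd !inE => /orP[]/eqP->; rewrite ?xz ?yz orbT.
Qed.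

Lemma gen_not_supset b F C : C \in gens_in b F -> ~~ (b \subset C) ->
  exists2 z, z \in b & F :|: (b :\ z) \notin D.
Proof.
move=> gC nb; have [/existsP[z /andP[zb h]]|/existsPn h] :=
  boolP [exists z, (z \in b) && (F :|: (b :\ z) \notin D)]; first by exists z.
case/negP: nb; apply: gen_supset gC _ => z zb.
by have := h z; rewrite zb /= negbK.
Qed.

Lemma face_proper F (G : {set 'I_n}) : F \proper G -> G \in D ->
  F = finset.set0 \/ exists u v, [/\ adj u v, F = [set u] & G = [set u; v]].
Proof.
move=> pFG GD; have := proper_card pFG => lt; have cG := card_face GD.
have FD : F \in D by apply: simplD GD (proper_sub pFG).
case: (faceP FD) => [->|[u eF]|[u [v [/adj_neq nuv eF]]]]; first by left.
  right; case/properP: pFG => sFG [v Gv]; rewrite eF inE eq_sym => nuv.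
  have eG : G = [set u; v].
    apply/esym/eqP; rewrite finset.eqEcard cards2 nuv cG andbT.
    by apply: pair_subset => //; apply: (fintype.subsetP sFG); rewrite eF inE.
  by exists u, v; split=> //; rewrite /adj nuv -eG.
by move: lt cG; rewrite eF cards2 nuv; case: #|G| => [|[|[]]].
Qed.

(** A two-valued function [g] on the deletion yields a cocycle supported on the generators
    containing [b]. Every vertex outside the hat forces [mu b] to be its value of [g], so [g] is
    constant. *)
Lemma H1_connected (K : fieldType) b :
  (forall a b, H1_trivial K a b) -> min_nonface D b -> #|b| = 2%N ->
  graph_connected (deletion D (hat D b)).
Proof.
move=> H1 mb cb g ge u0 v0; rewrite !deletion1.
have [x [y [nxy eb nadj]]] := min_nonface2P mb cb.
(* Vertices of the hat are ignored, so a vertex outside it passes its value to every edge that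
   contains it, including the edges leading into the hat. *)
pose t F : K := if [exists v, [&& v \in F, v \notin hat D b & g v]] then 1 else 0.
pose nu F C : K := if b \subset C then t F else 0.
have t_const F (G : {set 'I_n}) C : F \in faces_over finset.set0 b ->
    G \in faces_over finset.set0 b -> F \subset G -> C \in gens_in b F ->
    ~~ (b \subset C) -> t F = t G.
  move=> /faces_overP[_ _ Fb] /faces_overP[GD _ Gb] FG gC nbC.
  have [->//|nFG] := eqVneq F G.
  have pFG : F \proper G by rewrite finset.properEneq nFG.
  have [z zb FzD] := gen_not_supset gC nbC.
  case: (face_proper pFG GD) => [F0|[u [v [uv eF eG]]]].
    have [/gens_inP[mC sC] _] := (gC, F0); case/negP: nbC.
    by rewrite F0 finset.set0U in sC; rewrite (min_nonface_inj mC mb sC).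
  (* A common neighbor [u] of both elements of [b] would make [F :|: (b :\ z)] an edge. *)
  have uh : u \notin hat D b.
    apply: contra FzD; rewrite eF eb mem_hat2.
    have ub : u \notin b by apply: Fb; rewrite eF inE.
    have [nux nuy] : u != x /\ u != y.
      by move: ub; rewrite eb !inE negb_or => /andP.
    rewrite (negPf nux) (negPf nuy) /= => /andP[/andP[_ xu] /andP[_ yu]].
    move: zb; rewrite eb !inE => /orP[]/eqP->; rewrite ?pairD1l ?pairD1r //;
    by rewrite finset.setUC.
  have tF : [exists v, [&& v \in F, v \notin hat D b & g v]] = g u.
    apply/existsP/idP => [[w]|gu]; last by exists u; rewrite eF inE eqxx uh.
    by rewrite eF inE => /and3P[/eqP->].
  have tG : [exists v, [&& v \in G, v \notin hat D b & g v]] = g u.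
    apply/existsP/idP => [[w]|gu]; last by exists u; rewrite eG in_set2 eqxx uh.
    rewrite eG in_set2 => /and3P[/orP[]/eqP->// vh gv].
    by rewrite (ge u v) // deletion2 uh vh; case/andP: uv => _ ->.
  by rewrite /t tF tG.
have [|mu [mu0 Hmu]] := H1 finset.set0 b nu.
  split=> [F C _ _ /negPf nb|F G C C' oF oG FG gC gC']; first by rewrite /nu nb.
  have [bC|nbC] := boolP (b \subset C); have [bC'|nbC'] := boolP (b \subset C').
  - by rewrite /nu bC bC' !subrr.
  - by rewrite /nu bC (negPf nbC') (t_const _ _ _ oF oG FG gC' nbC').
  - by rewrite /nu bC' (negPf nbC) (t_const _ _ _ oF oG FG gC nbC).
  - by rewrite /nu (negPf nbC) (negPf nbC') !subrr.
have key v : v \notin hat D b -> mu b = if g v then 1 else 0.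
  move=> vh; move: (vh); rewrite {1}eb mem_hat2 !negb_or => /and3P[nvx nvy nadj2].
  have vb : v \notin b by rewrite eb !inE negb_or nvx.
  have oF : [set v] \in faces_over finset.set0 b.
    by apply/faces_overP; split; rewrite ?vertD ?finset.sub0set // => z; rewrite inE => /eqP->.
  (* The nonedge {z, v} is a generator that does not contain [b], so it normalizes the face {v}. *)
  have [z zb nzv] : exists2 z, z \in b & ~~ adj z v.
    by move: nadj2; rewrite negb_and => /orP[]; [exists x|exists y]; rewrite // eb !inE eqxx ?orbT.
  have nzv' : z != v by apply: contraNneq vb => <-.
  have mC := min_nonface2 nzv' nzv.
  have nbC : ~~ (b \subset [set z; v]).
    by apply/negP => /(min_nonface_inj mb mC) eC; rewrite -eC !inE eqxx orbT in vb.
  have gb : b \in gens_in b [set v] by apply/gens_inP; split=> //; apply: finset.subsetUr.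
  have gC : [set z; v] \in gens_in b [set v].
    by apply/gens_inP; split=> //; apply: pair_subset; rewrite !inE ?zb ?eqxx ?orbT.
  have := Hmu _ _ _ oF gb gC; rewrite (mu0 _ nbC) subr0 /nu fintype.subxx (negPf nbC) subr0.
  move=> <-; rewrite /t; congr (if _ then _ else _).
  apply/existsP/idP => [[w]|gv]; last by exists v; rewrite inE eqxx vh.
  by rewrite inE => /and3P[/eqP->].
move=> uh vh; have := key _ uh; rewrite (key _ vh).
case: (g u0); case: (g v0) => // /eqP; last by rewrite oner_eq0.
by rewrite eq_sym oner_eq0.
Qed.

Lemma cycle_not_dominating (s : seq 'I_n) : ~ dominating D [set v in s] ->
  exists x, forall v, v \in s -> (v != x) && ~~ adj v x.
Proof.
move=> nd; have [x nx] : exists x, x \notin \bigcup_(v in [set v in s]) nbhd D v.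
  by apply/existsP; rewrite -negb_forall; apply/negP => /forallP h; apply: nd;
     apply/finset.setP => z; rewrite h inE.
exists x => v vs; apply: contraR nx => h.
apply/finset.bigcupP; exists v; first by rewrite inE.
by move: h; rewrite mem_nbhd negb_and !negbK.
Qed.

Lemma gens_in1_vertex x u C : u != x -> ~~ adj u x -> C \in gens_in [set x] [set u] ->
  C = [set u; x].
Proof.
by move=> nux aux /gens_inP[mC sC]; rewrite (min_nonface_inj mC (min_nonface2 nux aux) sC).
Qed.

Lemma gens_in0_vertex x C : C \in gens_in [set x] finset.set0 -> False.
Proof.
by rewrite inE finset.set0U => /andP[/andP[/negP CD _] sC]; apply/CD/(simplD (vertD x)).
Qed.

Lemma gens_in1_supset x F C : F \in D -> C \in gens_in [set x] F -> [set x] \subset C.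
Proof.
move=> FD /gen_supset; apply=> z; rewrite inE => /eqP->.
by rewrite finset.setDv finset.setU0.
Qed.

(** If a cycle misses [x], then v -> [mu [set v; x]] would be a potential on it for weights that are
    1 on a single edge and 0 on the others. The sum around the cycle would be 1 instead of 0. *)
Lemma H1_dominating (K : fieldType) (s : seq 'I_n) :
  (forall a b, H1_trivial K a b) -> is_cycle D s -> dominating D [set v in s].
Proof.
move=> H1 /and3P[s3 us cs]; apply: contrapT => /cycle_not_dominating[x Hx].
case: s s3 us cs Hx => [|v1 [|v2 [|v3 s]]] // _ us cs Hx.
pose e0 := [set v1; v2]; pose b := [set x].
(* Over the edge [e0] the pairs {v1, x} and {v2, x} are generators; the asymmetry between them is
   the weight 1 of this edge. *)
pose nu F C : K := if (F == e0) && (v1 \in C) then 1 else 0.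
have n12 : v1 != v2 by move: us; rewrite /= !inE negb_or => /andP[/andP[]].
have e0D : e0 \in D by move: cs => /= /andP[].
have [|mu [mu0 Hmu]] := H1 finset.set0 b nu.
  split=> [F C /faces_overP[FD _ _] gC|F G C C' /faces_overP[FD _ _] /faces_overP[GD _ _] FG gC gC'].
    by rewrite (gens_in1_supset FD gC).
  have [->//|nFG] := eqVneq F G.
  have pFG : F \proper G by rewrite finset.properEneq nFG.
  case: (face_proper pFG GD) => [F0|[u [v [uv eF eG]]]].
    by rewrite F0 in gC; case: (gens_in0_vertex gC).
  have nF : (F == e0) = false.
    by apply/eqP => eF0; move/(congr1 (fun A : {set _} => #|A|)): eF0; rewrite eF cards1 cards2 n12.
  rewrite {1 2}/nu nF /= subrr /nu; case: eqP => [eG0|]; last by rewrite subrr.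
  have /Hx/andP[nux aux] : u \in [:: v1, v2, v3 & s].
    have : u \in e0 by rewrite -eG0 eG !inE eqxx.
    by rewrite !inE => /orP[]/eqP->; rewrite eqxx ?orbT.
  rewrite eF in gC gC'.
  by rewrite (gens_in1_vertex nux aux gC) (gens_in1_vertex nux aux gC') subrr.
pose q v := mu [set v; x].
have edge u v : u \in [:: v1, v2, v3 & s] -> v \in [:: v1, v2, v3 & s] -> [set u; v] \in D ->
    nu [set u; v] [set u; x] - nu [set u; v] [set v; x] = q u - q v.
  move=> /Hx/andP[nux aux] /Hx/andP[nvx avx] uvD; apply: Hmu.
  - apply/faces_overP; split; rewrite ?finset.sub0set // => z.
    by rewrite !inE => /orP[]/eqP->.
  - apply/gens_inP; split; first exact: min_nonface2.
    by apply: pair_subset; rewrite !inE eqxx ?orbT.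
  - apply/gens_inP; split; first exact: min_nonface2.
    by apply: pair_subset; rewrite !inE eqxx ?orbT.
have edge' u v : u \in [:: v1, v2, v3 & s] -> v \in [:: v1, v2, v3 & s] -> [set u; v] \in D ->
    [set u; v] != e0 -> q u = q v.
  move=> us' vs' uvD /negPf ne; have := edge _ _ us' vs' uvD.
  by rewrite /nu ne subrr => /esym/eqP; rewrite subr_eq0 => /eqP.
have q12 : q v1 - q v2 = 1.
  rewrite -edge ?inE ?eqxx ?orbT // /nu eqxx !inE eqxx (negPf n12) /=.
  have /Hx/andP[/negPf-> _] : v1 \in [:: v1, v2, v3 & s] by rewrite inE eqxx.
  by rewrite subr0.
(* A walk that avoids [v1] never uses [e0], so the potential is constant along it. *)
have walk p z : {subset z :: p <= [:: v2, v3 & s]} -> path (fun v w => [set v; w] \in D) z p ->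
    q z = q (last z p).
  elim: p z => //= w p IH z sub /andP[zw pw].
  have zs : z \in [:: v2, v3 & s] by apply: sub; rewrite inE eqxx.
  have ws : w \in [:: v2, v3 & s] by apply: sub; rewrite !inE eqxx orbT.
  rewrite (edge' z w) ?zw //; [|by rewrite inE zs orbT|by rewrite inE ws orbT|].
    by apply: IH pw => r rp; apply: sub; rewrite inE rp orbT.
  apply/negP => /eqP/finset.setP/(_ v1); rewrite !inE eqxx /= => h.
  have : v1 \in [:: v2, v3 & s] by move: h => /orP[]/eqP->.
  by move: us; rewrite cons_uniq => /andP[/negPf->].
move: cs; rewrite /= rcons_path => /andP[_ /andP[c23 /andP[pc lc]]].
have l2 : last v3 s \in v3 :: s by apply: mem_last.
have q2l : q v2 = q (last v3 s).
  by apply: (walk (v3 :: s) v2) => //=; rewrite c23.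
have ql1 : q (last v3 s) = q v1.
  apply: edge' => //.
  - by rewrite 2!inE l2 !orbT.
  - by rewrite inE eqxx.
  apply/eqP => /finset.setP/(_ v2); rewrite !inE eqxx orbT => /orP[]/eqP e2.
    by move: us; rewrite /= e2 l2 andbF.
  by rewrite e2 eqxx in n12.
by move: q12; rewrite q2l ql1 subrr => /eqP; rewrite eq_sym oner_eq0.
Qed.

(** * Criteria for a cocycle to be a coboundary *)

Section Vanishing.
Variable K : zmodType.
Implicit Types nu : {set 'I_n} -> {set 'I_n} -> K.

(* The faces of the relative part, on which cochains have a fixed normalization. *)
Definition based b F := [exists C in gens_in b F, ~~ (b \subset C)].

Lemma basedI a b F z : F \in faces_over a b -> z \in b -> F :|: (b :\ z) \notin D ->
  based b F.
Proof.
move=> /faces_overP[_ _ Fb] zb FzD.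
have sF : F :|: (b :\ z) \subset F :|: b by apply/finset.setUS/finset.subD1set.
have [C gC sC] := nonface_gen FzD sF.
apply/existsP; exists C; rewrite gC; apply/negP => /fintype.subsetP/(_ z zb) zC.
move/(fintype.subsetP sC): zC; rewrite !inE eqxx /= orbF => /Fb.
by rewrite zb.
Qed.

(** Comparison with a generator that does not contain [b], where both values are 0, turns the
    equality of differences into an equality of values. *)
Lemma based_const a b nu F (G C : {set 'I_n}) : cocycle_over a b nu ->
  F \in faces_over a b -> G \in faces_over a b -> F \subset G ->
  based b F -> C \in gens_in b F -> nu F C = nu G C.
Proof.
move=> [c0 c1] oF oG FG /existsP[C0 /andP[gC0 nbC0]] gC.
have := c1 _ _ _ _ oF oG FG gC gC0.
by rewrite (c0 F C0) // (c0 G C0) ?(gens_inS FG) // !subr0.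
Qed.

(** Once the shifted values agree along inclusions, [mu C] can be read off at one face, and every
    other face having [C] among its generators contains that one. *)
Lemma coboundary_shift a b nu (t : {set 'I_n} -> K) :
  cocycle_over a b nu -> (forall F, F \in faces_over a b -> based b F -> t F = 0) ->
  (forall F (G C : {set 'I_n}), F \in faces_over a b -> G \in faces_over a b ->
     F \subset G -> C \in gens_in b F -> nu F C + t F = nu G C + t G) ->
  coboundary_over a b nu.
Proof.
(* The smallest candidate for a face over [a] and [b] with [C] among its generators. *)
move=> [c0 c1] t0 ht; pose FC C := (C :\: b) :|: a.
exists (fun C => if b \subset C then nu (FC C) C + t (FC C) else 0).
split=> [C /negPf->//|F C C' oF gC gC'].
suff E C1 : C1 \in gens_in b F ->
    (if b \subset C1 then nu (FC C1) C1 + t (FC C1) else 0) = nu F C1 + t F.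
  by rewrite !E // opprD addrACA subrr addr0.
move=> {gC} {gC'} gC; case: ifPn => bC; last first.
  rewrite (c0 _ _ oF gC bC) t0 ?addr0 //.
  by apply/existsP; exists C1; rewrite gC.
have [/gens_inP[mC sC] /faces_overP[FD aF Fb]] := (gC, oF).
have sFC : FC C1 \subset F.
  rewrite finset.subUset aF andbT; apply/fintype.subsetP => w.
  rewrite inE => /andP[/negPf nb /(fintype.subsetP sC)].
  by rewrite inE nb orbF.
apply: ht => //.
  apply/faces_overP; split; first exact: simplD FD sFC.
    exact: finset.subsetUr.
  by move=> w /(fintype.subsetP sFC); apply: Fb.
apply/gens_inP; split=> //; apply/fintype.subsetP => w wC.
by rewrite !inE wC andbT; case: (w \in b); rewrite ?orbT.
Qed.

(** A generator inside the union of [a] and [b] belongs to every face, so shifting each face to a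
    common value [r] at [C0] settles all inclusions at once. Based faces admit no shift and must
    already agree at [C0]. *)
Lemma coboundary_min a b nu C0 : cocycle_over a b nu -> a \in faces_over a b ->
  C0 \in gens_in b a ->
  (forall F (G : {set 'I_n}), F \in faces_over a b -> G \in faces_over a b ->
     based b F -> based b G -> nu F C0 = nu G C0) ->
  coboundary_over a b nu.
Proof.
move=> cnu oa gC0 h.
have [r hr] : exists r, forall F, F \in faces_over a b -> based b F -> nu F C0 = r.
  have [/existsP[F /andP[oF bF]]|/existsPn nF] := boolP [exists F in faces_over a b, based b F].
    by exists (nu F C0) => G oG bG; apply: h.
  by exists 0 => F oF bF; have := nF F; rewrite oF bF.
apply: (@coboundary_shift _ _ _ (fun F => r - nu F C0)) => // [F oF bF|F G C oF oG FG gC].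
  by rewrite hr ?subrr.
have [_ aF _] := faces_overP _ _ _ oF.
have := cnu.2 _ _ _ _ oF oG FG gC (gens_inS aF gC0).
by rewrite addrCA => ->; rewrite addrCA.
Qed.

End Vanishing.

(** * Sufficiency of the three conditions *)

Section Conditions.
Variable K : zmodType.
Hypothesis degD : forall v, (local_degree D v <= 3)%N.
Hypothesis cycD : forall s : seq 'I_n, is_cycle D s -> dominating D [set v in s].
Hypothesis conD : forall b, min_nonface D b -> #|b| = 2%N ->
  graph_connected (deletion D (hat D b)).

Lemma triangle_dominates x y z w : adj x y -> adj y z -> adj x z ->
  w \notin [:: x; y; z] -> [|| adj x w, adj y w | adj z w].
Proof.
move=> xy yz xz; rewrite !inE !negb_or => /and3P[wx wy wz].
have cyc : is_cycle D [:: x; y; z].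
  rewrite /is_cycle /= !inE negb_or (adj_neq xy) (adj_neq yz) (adj_neq xz) /=.
  by case/andP: xy => _ ->; case/andP: yz => _ ->; case/andP: xz => _; rewrite finset.setUC => ->.
have : w \in \bigcup_(v in [set v in [:: x; y; z]]) nbhd D v by rewrite (cycD cyc) inE.
case/finset.bigcupP => v; rewrite mem_nbhd !inE => /or3P[]/eqP->;
by rewrite eq_sym ?(negPf wx) ?(negPf wy) ?(negPf wz) => /= ->; rewrite ?orbT.
Qed.

(** * Connectedness of the complement of a triangle *)

Section Triangle.
Variables (B : {set 'I_n}) (f : 'I_n -> K).
Hypothesis cardB : #|B| = 3%N.
Hypothesis adjB : forall p q, p \in B -> q \in B -> p != q -> adj p q.
Hypothesis f_edge : forall p q, p \notin B -> q \notin B -> adj p q -> f p = f q.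

Lemma triangleE x y z : x \in B -> y \in B -> z \in B -> uniq [:: x; y; z] ->
  B =i [:: x; y; z].
Proof.
move=> xB yB zB u; apply: fsym; apply/subset_cardP.
  by rewrite cardB (card_uniqP u).
by apply/fintype.subsetP => w; rewrite !inE => /or3P[]/eqP->.
Qed.

Lemma triangle_third x y : x \in B -> y \in B -> x != y ->
  exists2 z, z \in B & uniq [:: x; y; z].
Proof.
move=> xB yB nxy.
have : (0 < #|B :\ x :\ y|)%N.
  have := cardsD1 x B; have := cardsD1 y (B :\ x); rewrite cardB !inE xB yB eq_sym nxy /=.
  by case: #|_ :\ y| => // -> .
rewrite card_gt0 => /finset.set0Pn[z]; rewrite !inE => /and3P[zy zx zB].
by exists z; rewrite //= !inE negb_or nxy ![_ == z]eq_sym zx zy.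
Qed.

(** Two of the at most three neighbors of [p] are in the triangle. *)
Lemma triangle_nbr_uniq p u v : p \in B -> u \notin B -> v \notin B ->
  adj p u -> adj p v -> u = v.
Proof.
move=> pB uB vB pu pv.
have [q qB npq] : exists2 q, q \in B & p != q.
  have : (0 < #|B :\ p|)%N by have := cardsD1 p B; rewrite cardB pB; case: #|_ :\ p|.
  rewrite card_gt0 => /finset.set0Pn[z]; rewrite !inE => /andP[zp zB].
  by exists z; rewrite // eq_sym.
have [r rB] := triangle_third pB qB npq.
rewrite /= !inE negb_or => /andP[/andP[_ npr] /andP[nqr _]].
have := degree_le3 (degD p) _ (adjB pB qB npq) (adjB pB rB npr) pu pv.
rewrite /= !inE negb_or nqr !andbT => /(_ _)/or3P[].
- by rewrite -negb_or; apply: contra uB => /orP[]/eqP<-.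
- by move/eqP => e; rewrite e qB in vB.
- by move/eqP => e; rewrite e rB in vB.
- by move/eqP.
Qed.

(** Condition (iii) for the nonedge {u, y}: its hat contains [y] and the common neighbor [x], so [z]
    is the only triangle vertex left in the deletion. It is connected there to [v], necessarily
    through its unique neighbor outside the triangle. *)
Lemma triangle_third_nbr x y z u v : x \in B -> y \in B -> z \in B -> uniq [:: x; y; z] ->
  u \notin B -> v \notin B -> adj x u -> adj y v -> u != v -> ~~ adj u v ->
  ~~ adj z u -> ~~ adj z v -> exists z', [/\ z' \notin B, adj z z' & f z' = f v].
Proof.
move=> xB yB zB uxyz uB vB xu yv nuv auv zu zv.
have outB p q : p \in B -> q \notin B -> p != q by move=> pB; apply: contraNneq => <-.
have yu : ~~ adj y u.
  by apply/negP => yu; move: nuv; rewrite (triangle_nbr_uniq yB uB vB yu yv) eqxx.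
have nuy : u != y by rewrite eq_sym outB.
have auy : ~~ adj u y by rewrite adjC.
move: (uxyz); rewrite /= !inE negb_or => /andP[/andP[nxy nxz] /andP[nyz _]].
have c2 : #|[set u; y]| = 2%N by rewrite cards2 nuy.
(* At [z], where [f] says nothing, the value is taken from the outer neighbor, and is false if there
   is none. *)
pose g w := if w == z then [exists z', [&& z' \notin B, adj z z' & f z' == f v]] else f w == f v.
have conn := conD (min_nonface2 nuy auy) c2 (g := g).
have Bz w q : w \notin B -> adj z w -> f w = f q -> g z = (f w == f v).
  move=> wB zw efw; rewrite /g eqxx; apply/existsP/idP => [[z' /and3P[z'B zz' fz']]|fw].
    by rewrite (triangle_nbr_uniq zB wB z'B zw zz').
  by exists w; rewrite wB zw.
have hE w : w \notin hat D [set u; y] -> w \notin B \/ w = z.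
  rewrite mem_hat2 !negb_or => /and3P[nwu nwy nadj].
  have [wB|] := boolP (w \in B); last by left.
  right; move: wB; rewrite (triangleE xB yB zB uxyz) !inE (negPf nwy) /=.
  case/orP => /eqP // ewx; move: nadj; rewrite ewx adjC xu adjC.
  by rewrite (adjB xB yB nxy).
have gE : g z = g v.
  apply: conn; last 2 first.
  - rewrite deletion1 mem_hat2 !negb_or outB //= eq_sym nyz /= negb_and.
    by rewrite adjC zu.
  - rewrite deletion1 mem_hat2 !negb_or eq_sym nuv eq_sym outB //=.
    by rewrite negb_and auv.
  move=> p q; rewrite deletion2 => /and3P[pq /hE ph /hE qh].
  have [->//|npq] := eqVneq p q.
  have apq : adj p q by rewrite /adj npq.
  have [epz|npz] := eqVneq p z; have [eqz|nqz] := eqVneq q z.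
  - by move: npq; rewrite epz eqz eqxx.
  - case: qh => [qB|/eqP]; last by rewrite (negPf nqz).
    by rewrite epz (Bz q q) // -?epz // /g (negPf nqz).
  - case: ph => [pB|/eqP]; last by rewrite (negPf npz).
    by rewrite eqz (Bz p p) // -?eqz 1?adjC // /g (negPf npz).
  - case: qh => [qB|/eqP]; last by rewrite (negPf nqz).
    case: ph => [pB|/eqP]; last by rewrite (negPf npz).
    by rewrite /g (negPf npz) (negPf nqz) (f_edge pB qB apq).
move: gE; rewrite {2}/g eq_sym (negPf (outB _ _ zB vB)) eqxx /g eqxx.
by move=> /existsP[z' /and3P[z'B zz' /eqP fz']]; exists z'.
Qed.

(** By (ii) both [u] and [v] are adjacent to the triangle, at distinct vertices x and y. The
    nonedges {u, y} and {v, x} give outer neighbors of the third vertex with the values [f v] and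
    [f u]; such a neighbor is unique. *)
Lemma triangle_connected u v : u \notin B -> v \notin B -> f u = f v.
Proof.
move=> uB vB; have [->//|nuv] := eqVneq u v.
have [auv|auv] := boolP (adj u v); first exact: f_edge.
have dom w : w \notin B -> exists2 x, x \in B & adj x w.
  move=> wB; have [x xB] : exists x, x \in B.
    by apply/finset.set0Pn; rewrite -card_gt0 cardB.
  have [y yB nxy] : exists2 y, y \in B & x != y.
    have : (0 < #|B :\ x|)%N by have := cardsD1 x B; rewrite cardB xB; case: #|_ :\ x|.
    rewrite card_gt0 => /finset.set0Pn[z]; rewrite !inE => /andP[zp zB].
    by exists z; rewrite // eq_sym.
  have [z zB ux] := triangle_third xB yB nxy.
  move: (ux); rewrite /= !inE negb_or => /andP[/andP[_ nxz] /andP[nyz _]].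
  have := triangle_dominates (adjB xB yB nxy) (adjB yB zB nyz) (adjB xB zB nxz).
  move=> /(_ w); rewrite -(triangleE xB yB zB ux) => /(_ wB)/or3P[] h.
  - by exists x.
  - by exists y.
  - by exists z.
have [x xB xu] := dom u uB; have [y yB yv] := dom v vB.
have nxy : x != y.
  apply/eqP => exy; rewrite -exy in yv.
  by move: nuv; rewrite (triangle_nbr_uniq xB uB vB xu yv) eqxx.
have [z zB ux] := triangle_third xB yB nxy.
move: (ux); rewrite /= !inE negb_or => /andP[/andP[_ nxz] /andP[nyz _]].
have outB p q : p \in B -> q \notin B -> p != q by move=> pB; apply: contraNneq => <-.
(* If [r] is adjacent to two triangle vertices, the new triangle {p, q, r} dominates [s] as well.
   This excludes [z] from being adjacent to [u] or [v]. *)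
have no_apex p q r s : p \in B -> q \in B -> p != q -> r \notin B -> s \notin B ->
    adj p r -> adj q r -> r != s -> ~~ adj r s -> adj p s || adj q s.
  move=> pB qB npq rB sB pr qr nrs ars.
  have := triangle_dominates (adjB pB qB npq) qr pr.
  move=> /(_ s); rewrite !inE !negb_or ![s == _]eq_sym (outB p) // (outB q) // nrs => /(_ isT).
  by rewrite (negPf ars) orbF.
have zu : ~~ adj z u.
  apply/negP => zu; have := no_apex _ _ _ _ xB zB nxz uB vB xu zu nuv auv.
  case/orP => h; move: nuv.
    by rewrite (triangle_nbr_uniq xB uB vB xu h) eqxx.
  by rewrite (triangle_nbr_uniq zB uB vB zu h) eqxx.
have zv : ~~ adj z v.
  have nvu : v != u by rewrite eq_sym.
  have avu : ~~ adj v u by rewrite adjC.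
  apply/negP => zv; have := no_apex _ _ _ _ yB zB nyz vB uB yv zv nvu avu.
  case/orP => h; move: nvu.
    by rewrite (triangle_nbr_uniq yB vB uB yv h) eqxx.
  by rewrite (triangle_nbr_uniq zB vB uB zv h) eqxx.
have [z1 [z1B zz1 <-]] := triangle_third_nbr xB yB zB ux uB vB xu yv nuv auv zu zv.
have uy : uniq [:: y; x; z] by rewrite /= !inE negb_or eq_sym nxy nyz nxz.
have nvu : v != u by rewrite eq_sym.
have avu : ~~ adj v u by rewrite adjC.
have [z2 [z2B zz2 <-]] := triangle_third_nbr yB xB zB uy vB uB yv xu nvu avu zv zu.
by rewrite (triangle_nbr_uniq zB z1B z2B zz1 zz2).
Qed.

End Triangle.

(** By (ii) the vertices outside the neighborhood of [x] induce a forest, and a potential for the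
    weights [w] gives the shifts. No face is based here, since every generator contains [x]. *)
Lemma H1_vertex x : H1_trivial K finset.set0 [set x].
Proof.
move=> nu cnu; pose Z u := (u != x) && ~~ adj u x.
pose e u v := [&& adj u v, Z u & Z v].
pose w u v := nu [set u; v] [set u; x] - nu [set u; v] [set v; x].
have [||||p Hp] := @acyclic_potential _ K e w.
- by move=> u v; rewrite /e adjC [Z u && _]andbC.
- by move=> u; rewrite /e adj_irrefl.
- by move=> u v _; rewrite /w opprB finset.setUC.
- move=> s s2 us; apply/negP => cs.
  have cyc : is_cycle D s.
    rewrite /is_cycle s2 us /=; apply: sub_cycle cs => u v.
    by case/and3P=> /andP[].
  have : x \in \bigcup_(v in [set v in s]) nbhd D v by rewrite (cycD cyc) inE.
  case/finset.bigcupP => v; rewrite mem_nbhd inE => vs.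
  have /and3P[_ /andP[/negPf-> /negPf-> _]] := next_cycle cs vs.
  by [].
(* The shifted value at {z, x} becomes [p z]. On an edge with two admissible [z] the choice is
   immaterial, because [p] accounts for the weight of the edge. *)
pose t F := if [pick z in F | Z z] is Some z then p z - nu F [set z; x] else 0.
apply: (@coboundary_shift K _ _ _ t) => // [F /faces_overP[FD _ _]|F G C oF oG FG gC].
  by case/existsP => C /andP[gC]; rewrite (gens_in1_supset FD gC).
have [->//|nFG] := eqVneq F G.
have pFG : F \proper G by rewrite finset.properEneq nFG.
have [GD _ _] := faces_overP _ _ _ oG.
case: (face_proper pFG GD) => [F0|[u [v [uv eF eG]]]].
  by rewrite F0 in gC; case: (gens_in0_vertex gC).
have [FD _ Fb] := faces_overP _ _ _ oF.
have nux : u != x by have := Fb u; rewrite eF !inE eqxx => /(_ isT).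
have aux : ~~ adj u x.
  apply/negP => /andP[_ uxD]; move: gC => /gens_inP[/andP[/negP CD _] sC].
  by apply: CD; apply: simplD uxD _; rewrite -eF.
have Zu : Z u by rewrite /Z nux aux.
have eC : C = [set u; x] by rewrite eF in gC; apply: gens_in1_vertex gC.
have shiftF : nu F C + t F = p u.
  rewrite /t eC; case: pickP => [z|/(_ u)]; last by rewrite eF inE eqxx Zu.
  by rewrite eF inE => /andP[/eqP-> _]; rewrite addrC subrK.
rewrite shiftF /t eC; case: pickP => [z|/(_ u)]; last by rewrite eG !inE eqxx Zu.
rewrite eG in_set2 => /andP[/orP[]/eqP-> Zz]; first by rewrite addrC subrK.
rewrite addrCA -/(w u v) -Hp; first by rewrite addrC subrK.
by rewrite /e uv Zu.
Qed.

(** All edges avoiding b = {x, y} are based. A vertex that is not based is adjacent to both [x] and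
    [y], so by (i) at most one such edge contains it, and the vertex can be shifted to agree with
    that edge. *)
Lemma H1_edge x y : adj x y -> H1_trivial K finset.set0 [set x; y].
Proof.
move=> xy nu cnu; set b := [set x; y].
have nxy := adj_neq xy.
pose t F := if based b F then 0 else
  if [pick G in faces_over finset.set0 b | F \proper G] is Some G then
    if [pick C in gens_in b F] is Some C then nu G C - nu F C else 0
  else 0.
apply: (@coboundary_shift K _ _ _ t) => // [F _ bF|F G C oF oG FG gC].
  by rewrite /t bF.
have [->//|nFG] := eqVneq F G.
have pFG : F \proper G by rewrite finset.properEneq nFG.
have [GD _ Gb] := faces_overP _ _ _ oG; have [FD _ Fb] := faces_overP _ _ _ oF.
case: (face_proper pFG GD) => [F0|[u [v [uv eF eG]]]].
  move: gC => /gens_inP[/andP[/negP CD _] sC]; case: CD.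
  by move: sC; rewrite F0 finset.set0U; apply: simplD; case/andP: xy.
have [xb yb] : x \in b /\ y \in b by rewrite !inE !eqxx orbT.
have bneq p q : p \in G -> q \in b -> q != p.
  by move=> /Gb + qb; apply: contraNneq => <-.
have [uG vG] : u \in G /\ v \in G by rewrite eG !inE !eqxx orbT.
have bG : based b G.
  apply: (basedI oG xb); rewrite pairD1l // eG; apply: triple_nonface.
  by rewrite /= !inE negb_or (adj_neq uv) ![_ == y]eq_sym !bneq.
rewrite [t G]/t bG addr0 /t; case: ifPn => bF.
  by rewrite addr0 (based_const cnu oF oG FG bF gC).
have adjb z : z \in b -> F :|: (b :\ z) \in D.
  by move=> zb; apply: contraNT bF => h; apply: basedI oF zb h.
have ux : adj u x.
  by rewrite /adj eq_sym bneq //; have := adjb y yb; rewrite pairD1r // eF.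
have uy : adj u y.
  by rewrite /adj eq_sym bneq //; have := adjb x xb; rewrite pairD1l // eF.
case: pickP => [G' /andP[oG' pFG']|/(_ G)]; last by rewrite oG pFG.
have [G'D _ G'b] := faces_overP _ _ _ oG'.
have eG' : G' = G.
  case: (face_proper pFG' G'D) => [F0|[u' [v' [uv' eF' eG']]]].
    by move/finset.setP: F0 => /(_ u); rewrite eF !inE eqxx.
  have eu : u' = u by apply/eqP; rewrite -finset.in_set1 -eF eF' inE.
  subst u'; rewrite eG eG'; congr [set _; _].
  have := degree_le3 (degD u) _ ux uy uv uv'; rewrite /= !inE negb_or nxy !bneq //.
  move=> /(_ isT)/or3P[]/eqP // ev.
    by have := G'b v'; rewrite eG' !inE eqxx orbT ev eqxx => /(_ isT).
  by have := G'b v'; rewrite eG' !inE eqxx orbT ev eqxx orbT => /(_ isT).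
rewrite eG'; case: pickP => [C' gC'|/(_ C)]; last by rewrite gC.
by rewrite addrCA (cnu.2 _ _ _ _ oF oG FG gC gC') addrC subrK.
Qed.

(** The based faces are edges from [u] to a third neighbor, and by (i) there is at most one. *)
Lemma H1_star u x y C0 (nu : {set 'I_n} -> {set 'I_n} -> K) : x != y -> adj u x -> adj u y ->
  cocycle_over [set u] [set x; y] nu ->
  C0 \in gens_in [set x; y] [set u] -> [set u] \in faces_over [set u] [set x; y] ->
  coboundary_over [set u] [set x; y] nu.
Proof.
move=> nxy ux uy cnu gC0 ou; apply: (coboundary_min cnu ou gC0).
have shape F : F \in faces_over [set u] [set x; y] -> based [set x; y] F ->
    exists v, [/\ v != x, v != y, adj u v & F = [set u; v]].
  move=> /faces_overP[FD uF Fb] /existsP[C /andP[gC nbC]].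
  have [eF|nF] := eqVneq [set u] F.
    have [z zb] := gen_not_supset gC nbC; rewrite -eF.
    move: zb; rewrite !inE => /orP[]/eqP->; rewrite ?pairD1l ?pairD1r //.
      by case/andP: uy => _ ->.
    by case/andP: ux => _ ->.
  have pF : [set u] \proper F by rewrite finset.properEneq nF.
  case: (face_proper pF FD) => [/finset.setP/(_ u)|[u' [v [uv eu eF]]]].
    by rewrite !inE eqxx.
  have eu' : u' = u by apply/eqP; rewrite -finset.in_set1 eu inE.
  subst u'; exists v; have := Fb v; rewrite eF !inE eqxx orbT negb_or => /(_ isT)/andP[-> ->].
  by [].
move=> F G oF oG /(shape _ oF)[v [nvx nvy uv ->]] /(shape _ oG)[w [nwx nwy uw ->]].
have := degree_le3 (degD u) _ ux uy uv uw; rewrite /= !inE negb_or nxy ![_ == v]eq_sym nvx nvy.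
by rewrite (negPf nwx) (negPf nwy) /= => /(_ isT)/eqP->.
Qed.

(** The degrees of [p] and [q] are used up by [x], [y] and each other, while the triangles {x, p, q}
    and {y, p, q} dominate [w]; so [x] and [y] themselves must be adjacent to it. *)
Lemma common_edge x y p q w : x != y -> adj p q -> adj x p -> adj y p -> adj x q ->
  adj y q -> w \notin [:: x; y; p; q] -> [/\ adj x w, adj y w & ~~ adj p w].
Proof.
move=> nxy pq xp yp xq yq; rewrite !inE !negb_or => /and4P[nwx nwy nwp nwq].
have full r s : adj r s -> adj x r -> adj y r -> adj x s -> adj y s -> w != s -> ~~ adj r w.
  rewrite [adj x r]adjC [adj y r]adjC => rs xr yr xs ys nws; apply/negP => rw.
  have := degree_le3 (degD r) _ xr yr rs rw; rewrite /= !inE negb_or nxy.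
  rewrite (adj_neq xs) (adj_neq ys) => /(_ isT).
  by rewrite (negPf nwx) (negPf nwy) (negPf nws).
have pw := full p q pq xp yp xq yq nwq.
have qp : adj q p by rewrite adjC.
have qw := full q p qp xq yq xp yp nwp.
have dom z : adj z p -> adj z q -> w != z -> adj z w.
  move=> zp zq nwz; have := triangle_dominates zp pq zq (w := w).
  by rewrite !inE !negb_or nwz nwp nwq (negPf pw) (negPf qw) !orbF => /(_ isT).
by split=> //; apply: dom.
Qed.

(** Every vertex outside {x, y} is adjacent to [x]. If an edge zz' had [z] outside {p, q}, the
    neighbors of [x] would be exactly p, q, z; but [z] is adjacent to none of these. *)
Lemma common_edge_unique x y p q w w' : x != y -> adj p q -> adj x p -> adj y p ->
  adj x q -> adj y q -> w \notin [set x; y] -> w' \notin [set x; y] -> adj w w' ->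
  [set w; w'] = [set p; q].
Proof.
move=> nxy pq xp yp xq yq.
have key z z' : z \notin [set x; y] -> z' \notin [set x; y] -> adj z z' -> z \in [set p; q].
  move=> nz nz' zz'; apply/negPn/negP => nzpq.
  have zl : z \notin [:: x; y; p; q].
    by move: nz nzpq; rewrite !inE !negb_or => /andP[-> ->] /andP[-> ->].
  have [xz yz pz] := common_edge nxy pq xp yp xq yq zl.
  have qp : adj q p by rewrite adjC.
  have zl' : z \notin [:: x; y; q; p].
    by move: zl; rewrite !inE ![(z == p) || _]orbC.
  have [_ _ qz] := common_edge nxy qp xq yq xp yp zl'.
  have xz' : adj x z'.
    have [zl2|] := boolP (z' \in [:: x; y; p; q]); last first.
      by case/(common_edge nxy pq xp yp xq yq).
    move: nz' zl2; rewrite !inE negb_or => /andP[/negPf-> /negPf->] /=.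
    by case/orP => /eqP->.
  have := degree_le3 (degD x) _ xp xq xz xz'; rewrite /= !inE negb_or (adj_neq pq).
  move: nzpq; rewrite !inE negb_or ![z == _]eq_sym => /andP[-> ->] /(_ isT).
  case/or3P => /eqP e; move: zz'; rewrite e.
  - by rewrite adjC (negPf pz).
  - by rewrite adjC (negPf qz).
  - by rewrite adj_irrefl.
move=> nw nw' ww'; apply/eqP; rewrite finset.eqEcard !cards2 (adj_neq ww') (adj_neq pq) andbT.
by apply: pair_subset; [apply: key ww' | apply: (key w' w); rewrite // adjC].
Qed.

(** Based faces with a vertex outside the hat share one value by (iii). The remaining based faces
    are edges between two common neighbors, and if such an edge exists it is the only based face. *)
Lemma H1_nonedge b C0 (nu : {set 'I_n} -> {set 'I_n} -> K) : min_nonface D b -> #|b| = 2%N ->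
  cocycle_over finset.set0 b nu ->
  C0 \in gens_in b finset.set0 -> finset.set0 \in faces_over finset.set0 b ->
  coboundary_over finset.set0 b nu.
Proof.
move=> mb cb cnu gC0 o0; apply: (coboundary_min cnu o0 gC0).
have [x [y [nxy eb nadj]]] := min_nonface2P mb cb.
have b_hat z : z \in b -> z \in hat D b by move=> zb; rewrite inE zb.
have overv v : v \notin b -> [set v] \in faces_over finset.set0 b.
  move=> vb; apply/faces_overP; split; rewrite ?finset.sub0set // => z.
  by rewrite inE => /eqP->.
have based_vP v : v \notin b -> based b [set v] = (v \notin hat D b).
  move=> vb; have [nvx nvy] : v != x /\ v != y.
    by move: vb; rewrite eb !inE negb_or => /andP.
  apply/idP/idP.
    case/existsP => C /andP[gC nbC]; have [z zb] := gen_not_supset gC nbC.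
    apply: contra; rewrite eb mem_hat2 (negPf nvx) (negPf nvy) /= => /andP[/andP[_ xv] /andP[_ yv]].
    move: zb; rewrite eb !inE => /orP[]/eqP->; rewrite ?pairD1l ?pairD1r //;
    by rewrite finset.setUC.
  rewrite eb mem_hat2 (negPf nvx) (negPf nvy) /= -eb negb_and => /orP[] h.
    apply: (@basedI finset.set0 b _ y); rewrite ?overv //; first by rewrite eb !inE eqxx orbT.
    by move: h; rewrite eb pairD1r // finset.setUC /adj eq_sym nvx.
  apply: (@basedI finset.set0 b _ x); rewrite ?overv //; first by rewrite eb !inE eqxx.
  by move: h; rewrite eb pairD1l // finset.setUC /adj eq_sym nvy.
pose f v := nu [set v] C0.
have fE F v : F \in faces_over finset.set0 b -> v \in F -> v \notin hat D b -> nu F C0 = f v.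
  move=> oF vF vh; have vb : v \notin b by apply: contra vh; apply: b_hat.
  apply/esym; apply: (based_const cnu (overv _ vb) oF).
  - by rewrite finset.sub1set.
  - by rewrite based_vP.
  - by apply: gens_inS gC0; apply: finset.sub0set.
have fconst u v : u \notin hat D b -> v \notin hat D b -> f u = f v.
  move=> uh vh; have := conD mb cb (g := fun w => f w == f v).
  move=> /(_ _ u v); rewrite !deletion1 uh vh eqxx => h; apply/eqP; apply: h => //.
  move=> p q; rewrite deletion2 => /and3P[pq ph qh]; congr (_ == _).
  have oF : [set p; q] \in faces_over finset.set0 b.
    apply/faces_overP; split; rewrite ?finset.sub0set // => z.
    by rewrite !inE => /orP[]/eqP->; [apply: contra ph|apply: contra qh]; apply: b_hat.
  have pF : p \in [set p; q] by rewrite !inE eqxx.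
  have qF : q \in [set p; q] by rewrite !inE eqxx orbT.
  by rewrite -(fE _ _ oF pF ph) -(fE _ _ oF qF qh).
have shape F : F \in faces_over finset.set0 b -> based b F ->
    (exists2 v, v \in F & v \notin hat D b) \/
    (exists p q, [/\ F = [set p; q], adj p q, p \in hat D b & q \in hat D b]).
  move=> oF bF; have [FD _ Fb] := faces_overP _ _ _ oF.
  case: (faceP FD) => [eF|[v eF]|[p [q [pq eF]]]].
  - have /existsP[C /andP[/gens_inP[mC sC]]] := bF.
    by rewrite eF finset.set0U in sC; rewrite (min_nonface_inj mC mb sC) fintype.subxx.
  - have vF : v \in F by rewrite eF inE.
    by left; exists v; rewrite // -based_vP ?Fb // -eF.
  - have [ph|ph] := boolP (p \in hat D b); last by left; exists p; rewrite // eF !inE eqxx.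
    have [qh|qh] := boolP (q \in hat D b); last by left; exists q; rewrite // eF !inE eqxx orbT.
    by right; exists p, q.
have inner F G : F \in faces_over finset.set0 b -> G \in faces_over finset.set0 b ->
    (exists p q, [/\ F = [set p; q], adj p q, p \in hat D b & q \in hat D b]) ->
    based b G -> G = F.
  move=> oF oG [p [q [eF pq ph qh]]] bG.
  have [_ _ Fb] := faces_overP _ _ _ oF; have [GD _ Gb] := faces_overP _ _ _ oG.
  have nbr z : z \in F -> z \in hat D b -> adj x z /\ adj y z.
    move=> /Fb; rewrite eb mem_hat2 !inE negb_or => /andP[/negPf-> /negPf->] /=.
    by move/andP.
  have [xp yp] : adj x p /\ adj y p by apply: nbr; rewrite // eF !inE eqxx.
  have [xq yq] : adj x q /\ adj y q by apply: nbr; rewrite // eF !inE eqxx orbT.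
  case: (faceP GD) => [eG|[v eG]|[w [w' [ww' eG]]]].
  - have /existsP[C /andP[/gens_inP[mC sC]]] := bG.
    by rewrite eG finset.set0U in sC; rewrite (min_nonface_inj mC mb sC) fintype.subxx.
  - have vb : v \notin b by apply: Gb; rewrite eG inE.
    have vh : v \notin hat D b by rewrite -based_vP // -eG.
    case/negP: vh; rewrite eb mem_hat2.
    have [/eqP->|nvp] := boolP (v == p); first by rewrite xp yp !orbT.
    have [/eqP->|nvq] := boolP (v == q); first by rewrite xq yq !orbT.
    have [|-> -> _] := common_edge nxy pq xp yp xq yq (w := v); last by rewrite !orbT.
    by move: vb; rewrite eb !inE !negb_or nvp nvq => /andP[-> ->].
  rewrite eF eG; apply: (common_edge_unique nxy pq xp yp xq yq) => //;
  by rewrite -eb Gb // eG !inE eqxx ?orbT.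
move=> F G oF oG bF bG.
have [[v vF vh]|hF] := shape _ oF bF; last by rewrite (inner F G).
have [[w wG wh]|hG] := shape _ oG bG; last by rewrite (inner G F).
by rewrite (fE F v) // (fE G w) // (fconst v w).
Qed.

(** A vertex together with two vertices of [b] is too large for a face, so exactly the nonempty
    faces are based. Their values at [C0] are constant along edges, hence constant. *)
Lemma H1_triangle b C0 (nu : {set 'I_n} -> {set 'I_n} -> K) : #|b| = 3%N ->
  (forall p q, p \in b -> q \in b -> p != q -> adj p q) ->
  cocycle_over finset.set0 b nu ->
  C0 \in gens_in b finset.set0 -> finset.set0 \in faces_over finset.set0 b ->
  coboundary_over finset.set0 b nu.
Proof.
move=> cb adjb cnu gC0 o0; apply: (coboundary_min cnu o0 gC0).
pose f v := nu [set v] C0.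
have fE F v : F \in faces_over finset.set0 b -> v \in F -> nu F C0 = f v.
  move=> oF vF; have [_ _ Fb] := faces_overP _ _ _ oF.
  have ov : [set v] \in faces_over finset.set0 b.
    apply/faces_overP; split; rewrite ?finset.sub0set // => z.
    by rewrite inE => /eqP->; apply: Fb.
  apply/esym; apply: (based_const cnu ov oF).
  - by rewrite finset.sub1set.
  - have /finset.set0Pn[z zb] : b != finset.set0 by rewrite -card_gt0 cb.
    apply: (basedI ov zb); apply: nonface_card3.
    rewrite cardsU1 !inE (negPf (Fb _ vF)) andbF.
    by have := cardsD1 z b; rewrite zb cb add1n => -[<-].
  - by apply: gens_inS gC0; apply: finset.sub0set.
have f_edge p q : p \notin b -> q \notin b -> adj p q -> f p = f q.
  move=> pb qb /andP[_ pq].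
  have oF : [set p; q] \in faces_over finset.set0 b.
    apply/faces_overP; split; rewrite ?finset.sub0set // => z.
    by rewrite !inE => /orP[]/eqP->.
  have pF : p \in [set p; q] by rewrite !inE eqxx.
  have qF : q \in [set p; q] by rewrite !inE eqxx orbT.
  by rewrite -(fE _ _ oF pF) -(fE _ _ oF qF).
have fconst u v := triangle_connected cb adjb f_edge (u := u) (v := v).
have vert F : F \in faces_over finset.set0 b -> F = finset.set0 \/
    exists2 v, v \notin b & nu F C0 = f v.
  move=> oF; have [FD _ Fb] := faces_overP _ _ _ oF.
  have [->|/finset.set0Pn[v vF]] := eqVneq F finset.set0; first by left.
  by right; exists v; [apply: Fb|apply: fE].
have nbased0 : ~~ based b finset.set0.
  apply/negP => /existsP[C /andP[gC nbC]]; have [z zb] := gen_not_supset gC nbC.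
  have : #|b :\ z| == 2%N by have := cardsD1 z b; rewrite zb cb add1n => -[<-].
  rewrite finset.set0U => /cards2P[p [q [npq e]]]; rewrite e.
  have [] : p \in b /\ q \in b.
    by split; apply: (fintype.subsetP (finset.subD1set b z)); rewrite e !inE eqxx ?orbT.
  by move=> pb qb; have /andP[_ ->] := adjb p q pb qb npq.
move=> F G oF oG.
case: (vert F oF) => [->|[v vb ->]]; first by rewrite (negPf nbased0).
case: (vert G oG) => [->|[w wb ->]]; first by rewrite (negPf nbased0).
by move=> _ _; apply: fconst.
Qed.

(** Counting elements leaves few degrees. If [a :|: b] is a face, then [a] and [b] have at most two
    elements together. Otherwise either [a] is based, and then so are all faces and no shift occurs,
    or removing any element of [b] leaves a face and the total is at most three. *)
Theorem H1_vanishes a b : H1_trivial K a b.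
Proof.
move=> nu cnu.
have [oa|noa] := boolP (a \in faces_over a b); last first.
  have no F : F \in faces_over a b -> False.
    move=> /faces_overP[FD aF Fb]; case/negP: noa; apply/faces_overP; split=> //.
      exact: simplD FD aF.
    by move=> z /(fintype.subsetP aF); apply: Fb.
  by exists (fun=> 0); split=> // F C C' /no.
have [aD _ ab] := faces_overP _ _ _ oa.
have disj : [disjoint a & b] by move: oa; rewrite inE => /and3P[].
have cU : #|a :|: b| = (#|a| + #|b|)%N.
  by apply/eqP; rewrite (leq_card_setU a b).2.
have ca := card_face aD.
have [b0|/finset.set0Pn[z0 z0b]] := eqVneq b finset.set0.
  exists (fun=> 0); split=> // F C C' /faces_overP[FD _ _] /gens_inP[/andP[/negP CD _]].
  by rewrite b0 finset.setU0 => sC; case: CD; apply: simplD FD sC.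
have b1 : (0 < #|b|)%N by rewrite card_gt0; apply/finset.set0Pn; exists z0.
have set0U : a = finset.set0 -> a :|: b = b by move->; rewrite finset.set0U.
have [abD|abD] := boolP (a :|: b \in D).
  have := card_face abD; rewrite cU.
  case Ea: #|a| => [|k]; last first.
    case Eb: #|b| b1 => [|[|m]] // _; last by rewrite addSnnS !addnS.
    case: k Ea => [|k] Ea; [move=> _ | by rewrite addn1].
    (* With one element each, a proper inclusion starts at [F = a], which has no generators. *)
    apply: (@coboundary_shift K _ _ _ (fun=> 0)) => // F G C oF oG FG gC.
    have [->//|nFG] := eqVneq F G.
    have pFG : F \proper G by rewrite finset.properEneq nFG.
    have [GD _ Gb] := faces_overP _ _ _ oG; have [FD aF Fb] := faces_overP _ _ _ oF.
    case: (face_proper pFG GD) => [F0|[u [v [uv eF eG]]]].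
      by move: aF; rewrite F0 finset.subset0 -cards_eq0 Ea.
    have eFa : F = a by apply/esym/eqP; rewrite finset.eqEcard aF Ea eF cards1.
    move: gC => /gens_inP[/andP[/negP CD _] sC]; case: CD.
    by apply: simplD sC; rewrite eFa.
  have a0 : a = finset.set0 by apply/eqP; rewrite -cards_eq0 Ea.
  case Eb: #|b| b1 => [|[|[|m]]] // _ _; subst a.
    move/eqP/cards1P: Eb => [x eb]; rewrite eb in cnu *; exact: H1_vertex.
  move/eqP/cards2P: Eb => [x [y [nxy eb]]]; rewrite eb in cnu *; apply: H1_edge => //.
  by rewrite /adj nxy -eb -set0U.
have [C0 gC0 _] := nonface_gen abD (fintype.subxx _).
have [ba|nba] := boolP (based b a).
  apply: (@coboundary_shift K _ _ _ (fun=> 0)) => // F G C oF oG FG gC; rewrite !addr0.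
  have [_ aF _] := faces_overP _ _ _ oF.
  case/existsP: ba => C1 /andP[gC1 nbC1].
  apply: (based_const cnu oF oG FG) => //.
  by apply/existsP; exists C1; rewrite nbC1 (gens_inS aF).
have adjb z : z \in b -> a :|: (b :\ z) \in D.
  by move=> zb; apply: contraNT nba => h; apply: basedI oa zb h.
have cab : (#|a| + #|b| <= 3)%N.
  have := card_face (adjb z0 z0b).
  have -> : a :|: (b :\ z0) = (a :|: b) :\ z0.
    apply/finset.setP => z; rewrite !inE; case: eqVneq => //= ->.
    by rewrite orbF; apply: contraTF z0b; apply: ab.
  by have := cardsD1 z0 (a :|: b); rewrite cU !inE z0b orbT add1n => ->.
case Eb: #|b| b1 cab => [|[|[|m]]] // _ cab.
- apply: (coboundary_min cnu oa gC0) => F G /faces_overP[FD _ _] _ /existsP[C /andP[gC]].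
  move/eqP/cards1P: Eb => [x eb]; rewrite eb in gC *.
  by rewrite (gens_in1_supset FD gC).
- case Ea: #|a| cab => [|[|k]]; last by rewrite !addnS.
    have a0 : a = finset.set0 by apply/eqP; rewrite -cards_eq0 Ea.
    move=> _; subst a; apply: (H1_nonedge _ Eb cnu gC0 oa).
    rewrite finset.set0U in abD; rewrite /min_nonface abD; apply/forallP => F; apply/implyP.
    case/properP => /fintype.subsetP sF [z zb zF].
    apply: simplD (adjb z zb) _; rewrite finset.set0U; apply/fintype.subsetP => w wF.
    by rewrite !inE sF // andbT; apply: contraNneq zF => <-.
  move=> _; move/eqP/cards1P: Ea => [u ea]; subst a.
  move/eqP/cards2P: Eb => [x [y [nxy eb]]]; rewrite eb in cnu gC0 oa adjb ab *.
  have := ab u; rewrite !inE eqxx negb_or => /(_ isT)/andP[nux nuy].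
  apply: (H1_star nxy _ _ cnu gC0 oa).
    by rewrite /adj nux; have := adjb y; rewrite pairD1r // !inE eqxx orbT; apply.
  by rewrite /adj nuy; have := adjb x; rewrite pairD1l // !inE eqxx; apply.
- have a0 : a = finset.set0.
    by apply/eqP; rewrite -cards_eq0; move: cab; case: #|a| => // k; rewrite !addnS.
  have m0 : m = 0%N by move: cab; rewrite a0 finset.cards0; case: m {Eb}.
  subst a m; apply: (H1_triangle Eb _ cnu gC0 oa) => p q pb qb npq.
  have [r rb nr] : exists2 r, r \in b & (r != p) && (r != q).
    have : (0 < #|b :\ p :\ q|)%N.
      have := cardsD1 p b; have := cardsD1 q (b :\ p); rewrite Eb !inE pb qb eq_sym npq /=.
      by case: #|_ :\ q| => // ->.
    rewrite card_gt0 => /finset.set0Pn[z]; rewrite !inE => /and3P[zy zx zB].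
    by exists z; rewrite // zx zy.
  rewrite /adj npq; apply: simplD (adjb r rb) _; rewrite finset.set0U.
  by case/andP: nr => rp rq; apply: pair_subset; rewrite !inE ?pb ?qb andbT eq_sym.
Qed.

End Conditions.

Lemma H1_iff (K : fieldType) : (forall a b, H1_trivial K a b) <->
  [/\ forall v, (local_degree D v <= 3)%N,
      forall s : seq 'I_n, is_cycle D s -> dominating D [set v in s]
    & forall b, min_nonface D b -> #|b| = 2%N -> graph_connected (deletion D (hat D b))].
Proof.
split=> [H1|[h1 h2 h3] a b]; last exact: H1_vanishes.
split=> [v|s|b]; [exact: H1_degree H1|exact: H1_dominating H1|exact: H1_connected H1].
Qed.

End Graph.

(** * Geometric realization *)

Section Connectedness.
Variables (R : realType) (n : nat) (E : {set {set 'I_n}}).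
Hypothesis simplE : simplicial_complex E.

Local Notation dirac u := (delta_mx ord0 u : 'rV[R]_n).

Lemma dirac_realization u : [set u] \in E -> realization E (dirac u).
Proof.
move=> uE; split=> [i||].
- by rewrite mxE ler0n.
- rewrite (bigD1 u) //= mxE !eqxx big1 ?addr0 // => i /negPf nu.
  by rewrite mxE nu andbF.
- suff -> : [set i | dirac u ord0 i != 0]%SET = [set u] by [].
  apply/finset.setP => i; rewrite !inE mxE eqxx /=.
  by case: (i == u); rewrite ?oner_eq0 ?eqxx.
Qed.

Lemma realization_segment (x : 'rV[R]_n) u (t : R) :
  realization E x -> x ord0 u != 0 -> 0 <= t <= 1 ->
  realization E (dirac u + t *: (x - dirac u)).
Proof.
move=> [x0 x1 xE] xu /andP[t0 t1].
have coord i : (dirac u + t *: (x - dirac u)) ord0 i =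
    (1 - t) * dirac u ord0 i + t * x ord0 i.
  by rewrite !mxE mulrBl mul1r mulrBr -addrA [- _ + _]addrC.
split=> [i||].
- rewrite coord addr_ge0 ?mulr_ge0 ?subr_ge0 //.
  by rewrite mxE ler0n.
- rewrite (eq_bigr _ (fun i _ => coord i)) big_split -!mulr_sumr /= x1.
  rewrite (bigD1 u) //= mxE !eqxx big1 ?addr0 ?mulr1 ?subrK // => i /negPf nu.
  by rewrite mxE nu andbF.
- apply: simplE xE _; apply/fintype.subsetP => i; rewrite !inE coord.
  apply: contraNneq => xi0; rewrite xi0 mulr0 addr0 mxE eqxx /=.
  by case: (eqVneq i u) => [iu|_]; rewrite ?mulr0 //; rewrite -iu xi0 eqxx in xu.
Qed.

Lemma mass_continuous (g : 'I_n -> bool) :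
  continuous (fun x : 'rV[R]_n => \sum_(i | g i) x ord0 i).
Proof.
apply: continuous_big => [|i _]; first exact: add_continuous.
exact: coord_continuous.
Qed.

(** The support of a point is a face, on which [g] is constant; so the mass on [g] is 0 or 1. *)
Lemma mass_realization (g : 'I_n -> bool) (x : 'rV[R]_n) u :
  (forall v w, [set v; w] \in E -> g v = g w) ->
  realization E x -> x ord0 u != 0 -> \sum_(i | g i) x ord0 i = (g u)%:R.
Proof.
move=> gE [_ x1 xE] xu.
have gu i : x ord0 i != 0 -> g i = g u.
  move=> xi; apply: gE; apply: simplE xE _; apply/fintype.subsetP => j.
  by rewrite !inE => /orP[]/eqP->.
case gu1: (g u); last first.
  by apply: big1 => i gi; apply/eqP; apply: contraTT gi => /gu->; rewrite gu1.
rewrite -x1 [in RHS](bigID g) /= [X in _ = _ + X]big1 ?addr0 // => i gi.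
by apply/eqP; apply: contraNT gi => /gu->.
Qed.

Lemma realization_supp (x : 'rV[R]_n) : realization E x -> exists u, x ord0 u != 0.
Proof.
move=> [_ x1 _]; apply/existsP; rewrite -negb_forall; apply/negP => /forallP x0.
by move/eqP: x1; rewrite big1 1?eq_sym ?oner_eq0 // => i _; apply/eqP.
Qed.

Lemma complex_graph_connected :
  complex_connected R E <-> graph_connected E.
Proof.
split=> [conn g gE|conn].
  have imp u v : [set u] \in E -> [set v] \in E -> g u -> g v.
    move=> uE vE gu.
    (* The mass is 0 or 1, so the strict and the weak inequality with 1/2 cut out the same subset,
       which is both open and closed in the realization. *)
    pose B := (realization E `&` [set x : 'rV[R]_n | 2^-1 < \sum_(i | g i) x ord0 i])%classic.
    have diag w : (dirac w) ord0 w != 0 by rewrite mxE !eqxx oner_eq0.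
    have half : (2^-1 : R) < 1 by rewrite invf_lt1 ?ltr0n // ltr1n.
    have BA : B = realization E.
      apply: conn.
      - exists (dirac u); split; first exact: dirac_realization.
        by rewrite /= (mass_realization gE (dirac_realization uE) (diag u)) gu.
      - exists [set x : 'rV[R]_n | 2^-1 < \sum_(i | g i) x ord0 i]%classic => //.
        apply: (open_comp (f := fun x : 'rV[R]_n => \sum_(i | g i) x ord0 i)
                          (D := [set y | 2^-1 < y]%classic)).
          by move=> x _; apply: mass_continuous.
        exact: open_gt.
      - exists [set x : 'rV[R]_n | 2^-1 <= \sum_(i | g i) x ord0 i]%classic.
          apply: (preimage_closed (f := fun x : 'rV[R]_n => \sum_(i | g i) x ord0 i)
                          (D := [set y | 2^-1 <= y]%classic)).
            by move=> x _; apply: mass_continuous.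
          exact: closed_ge.
        apply/seteqP; split=> x [xA /= lt]; split=> //=; first exact: ltW.
        have [w xw] := realization_supp xA.
        move: lt; rewrite (mass_realization gE xA xw); case: (g w) => //.
        by rewrite invr_le0 lern0.
    have [_ /=] : B (dirac v) by rewrite BA; apply: dirac_realization.
    rewrite (mass_realization gE (dirac_realization vE) (diag v)); case: (g v) => //.
    by rewrite invr_lt0 ltrn0.
  by move=> u v uE vE; apply/idP/idP; apply: imp.
move=> B [x0 Bx0] [C1 oC1 BC1] [C2 cC2 BC2].
have BA : (B `<=` realization E)%classic by rewrite BC1 => x [].
(* The segment from a point to a vertex of its support stays in one face and is connected, so the
   clopen set [B] contains all of it or none. *)
have seg x u : realization E x -> x ord0 u != 0 -> B x <-> B (dirac u).
  move=> xA xu; pose c (t : R) : 'rV[R]_n := dirac u + t *: (x - dirac u).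
  pose P := (c @` `[0, 1])%classic.
  have cc : continuous c.
    move=> t; apply: cvgD; first exact: cvg_cst.
    exact: scalel_continuous.
  have connP : connected P.
    apply: connected_continuous_connected; first exact: segment_connected.
    exact: continuous_subspaceT.
  have PA : (P `<=` realization E)%classic.
    move=> _ [t /= t01 <-]; apply: realization_segment => //.
  have Px : P x.
    exists 1; first by rewrite /= in_itv /= ler01 lexx.
    by rewrite /c scale1r addrC subrK.
  have Pu : P (dirac u).
    exists 0; first by rewrite /= in_itv /= ler01 lexx.
    by rewrite /c scale0r addr0.
  have BP y : P y -> B y -> (B `&` P)%classic = P.
    move=> Py By; apply: connP.
    - by exists y.
    - exists C1 => //; rewrite BC1; apply/seteqP; split=> z.
        by move=> [[_ ?] ?].
      by move=> [Pz ?]; split=> //; split=> //; apply: PA.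
    - exists C2 => //; rewrite BC2; apply/seteqP; split=> z.
        by move=> [[_ ?] ?].
      by move=> [Pz ?]; split=> //; split=> //; apply: PA.
  split=> [Bx|Bu].
    by have [] : (B `&` P)%classic (dirac u) by rewrite (BP x).
  by have [] : (B `&` P)%classic x by rewrite (BP (dirac u)).
have suppE (x : 'rV[R]_n) u : realization E x -> x ord0 u != 0 -> [set u] \in E.
  move=> [_ _ xE] xu; apply: simplE xE _.
  by apply/fintype.subsetP => i; rewrite !inE => /eqP->.
have vE (u v : 'I_n) : [set u; v] \in E -> [set u] \in E.
  by move=> uvE; apply: simplE uvE _; rewrite finset.sub1set !inE eqxx.
pose g u := `[< B (dirac u) >].
have gE u v : [set u; v] \in E -> g u = g v.
  move=> uvE; have [->//|nuv] := eqVneq u v.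
  (* The midpoint of the edge has both ends in its support, which links the two vertices through
     [seg]. *)
  pose m := 2^-1 *: (dirac u + dirac v).
  have mA : realization E m.
    have h2 : (0 : R) <= 2^-1 by rewrite invr_ge0 ler0n.
    have uA := dirac_realization (vE _ _ uvE).
    split=> [i||].
    - by rewrite !mxE mulr_ge0 // addr_ge0 // ler0n.
    - have s1 w : \sum_i (dirac w) ord0 i = 1 :> R.
        rewrite (bigD1 w) //= mxE !eqxx big1 ?addr0 // => i /negPf nu.
        by rewrite mxE nu andbF.
      rewrite (eq_bigr (fun i => 2^-1 * ((dirac u) ord0 i + (dirac v) ord0 i))).
        by rewrite -mulr_sumr big_split /= !s1 mulVf // pnatr_eq0.
      by move=> i _; rewrite !mxE.
    - apply: simplE uvE _; apply/fintype.subsetP => i; rewrite !inE !mxE eqxx /=.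
      by case: (i == u); case: (i == v); rewrite //= addr0 mulr0 eqxx.
  have mu : m ord0 u != 0.
    by rewrite !mxE !eqxx (negPf nuv) /= addr0 mulr1 invr_eq0 pnatr_eq0.
  have mv : m ord0 v != 0.
    by rewrite !mxE !eqxx [v == u]eq_sym (negPf nuv) /= add0r mulr1 invr_eq0 pnatr_eq0.
  by apply/asboolP/asboolP => [/(seg _ _ mA mu)/(seg _ _ mA mv)|/(seg _ _ mA mv)/(seg _ _ mA mu)].
apply/seteqP; split=> // x xA.
have [w xw] := realization_supp xA; have [w0 xw0] := realization_supp (BA _ Bx0).
apply/(seg _ _ xA xw)/asboolP.
rewrite -/(g w) -(conn g gE w0 w (suppE _ _ (BA _ Bx0) xw0) (suppE _ _ xA xw)).
by apply/asboolP/(seg _ _ (BA _ Bx0) xw0).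
Qed.
End Connectedness.

(** * The second cotangent module *)

Section PairSyzygies.
Variables (S : comNzRingType) (J : finType) (g : J -> S).
Local Notation free := (free_mod S J).
Implicit Types (r s : S) (u v w : free).

Lemma free_scaleE r u j : (r *: u) j = r * u j :> S.
Proof. by rewrite ffunE. Qed.

Lemma free_subE u v j : (u - v) j = u j - v j :> S.
Proof. by rewrite !ffunE. Qed.

Lemma free_pairE r r' u v j : (r *: u - r' *: v) j = r * u j - r' * v j :> S.
Proof. by rewrite free_subE !free_scaleE. Qed.

Lemma gen_mapZ r u : gen_map g (r *: u) = r * gen_map g u :> S.
Proof. by rewrite linearZ. Qed.

(** The default 0 is taken when the two multiples have different images. *)
Definition pair_syz r r' u v : Syz g := insubd 0 (r *: u - r' *: v).

Lemma pair_syzE r r' u v : r * gen_map g u = r' * gen_map g v :> S ->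
  val (pair_syz r r' u v) = r *: u - r' *: v.
Proof.
move=> e; apply: insubdK; suff: gen_map g (r *: u - r' *: v) == 0 by [].
by rewrite linearB /= subr_eq0 !gen_mapZ e.
Qed.

Lemma pair_syz_scale s r r' u v : r * gen_map g u = r' * gen_map g v :> S ->
  pair_syz (s * r) (s * r') u v = s *: pair_syz r r' u v.
Proof.
move=> e; have e' : (s * r) * gen_map g u = (s * r') * gen_map g v :> S.
  by rewrite -!mulrA e.
apply: val_inj; rewrite linearZ /= !pair_syzE // scalerBr !scalerA.
reflexivity.
Qed.

Lemma pair_syz_add r r' r'' u v w : r * gen_map g u = r' * gen_map g v :> S ->
  r' * gen_map g v = r'' * gen_map g w :> S ->
  pair_syz r r' u v + pair_syz r' r'' v w = pair_syz r r'' u w.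
Proof.
move=> e e'; have e'' : r * gen_map g u = r'' * gen_map g w :> S by rewrite e.
apply: val_inj; rewrite raddfD /= !pair_syzE // addrA subrK.
reflexivity.
Qed.

Lemma pair_syz_Kosz s u v : pair_syz (s * gen_map g v) (s * gen_map g u) u v \in Kosz (g := g).
Proof.
apply: mem_span; exists v, (s *: u); rewrite pair_syzE; last first.
  by rewrite -!mulrA [X in _ * X]mulrC.
rewrite gen_mapZ scalerA (mulrC s (gen_map g v)).
reflexivity.
Qed.

Lemma linear_pair (V : lmodType S) (h : {linear free -> V}) r r' u v :
  h (r *: u - r' *: v) = r *: h u - r' *: h v.
Proof. by rewrite linearB !linearZ. Qed.

Lemma linear_scale (V W : lmodType S) (h : {linear V -> W}) r x : h (r *: x) = r *: h x.
Proof. exact: linearZ. Qed.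

Lemma syz_sumE (T : finType) (P : pred T) (F : T -> Syz g) j :
  val (\sum_(i | P i) F i) j = \sum_(i | P i) val (F i) j :> S.
Proof. by rewrite raddf_sum sum_ffunE. Qed.

Lemma syz_scaleE r (x : Syz g) j : val (r *: x) j = r * val x j :> S.
Proof. by rewrite linearZ /= free_scaleE. Qed.

Lemma free_hom_exists (V : lmodType S) (z : J -> V) :
  exists h : {linear free -> V}, forall u, h u = \sum_j (u j : S) *: z j.
Proof.
pose h u := \sum_j (u j : S) *: z j.
have hl : linear h.
  move=> r u v; rewrite /h scaler_sumr -big_split; apply: eq_bigr => j _ /=.
  by rewrite !ffunE scalerDl scalerA.
pose H : {linear free -> V} := HB.pack h (GRing.isLinear.Build S free V _ h hl).
by exists H.
Qed.

Variables (I : submodClosed S^o) (gI : forall j, g j \in I).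

(** Unfolds the cokernel and the quotient by [Kosz], so that only maps on syzygies have to be
    handled. *)
Lemma T2_trivialP : (forall t : T2 gI, t = 0) <->
  forall f : {linear Syz g -> quotmod I}, (forall s : Syz g, s \in Kosz (g := g) -> f s = 0) ->
    exists h : {linear free -> quotmod I}, forall s : Syz g, f s = h (val s).
Proof.
split=> [T0 f fK|hyp t].
  have /eqP := T0 (\pi_(T2 gI)%qT (quot_lift fK)).
  rewrite pi_eq0 => /asboolP[h Eh]; exists h => s.
  by rewrite -(quot_lift_pi fK) Eh restriction_pi.
elim/quotW: t => phi; apply/eqP; rewrite pi_eq0; apply/asboolP.
have [s sK|h Eh] := hyp (phi \o \pi_(quotmod (Kosz (g := g)))%qT).
  have /eqP e : \pi_(quotmod (Kosz (g := g)))%qT s == 0 by rewrite pi_eq0.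
  by rewrite /= e linear0.
exists h; apply: hom_ext; elim/quotW => s.
by rewrite restriction_pi -Eh.
Qed.

End PairSyzygies.

(** * Monomials and coefficients in the Stanley-Reisner ring *)

Section Algebra.
Variables (K : fieldType) (n : nat).
Implicit Types (m k l p e : multinom n) (F C : {set 'I_n}).
Local Notation S := (mpoly n K).
Local Notation X := (mpolyX K).
Local Infix "+m" := (@mnm_add n) (at level 50, left associativity).
Local Infix "-m" := (@mnm_sub n) (at level 50, left associativity).
Local Infix "<=m" := (@lem n) (at level 70).

Definition mnm_supp m : {set 'I_n} := [set i | m i != 0%N].
Definition mnm_ind F : multinom n := Multinom [tuple (i \in F : nat) | i < n].

Lemma mnm_indE F i : mnm_ind F i = (i \in F).
Proof. by rewrite mnmE. Qed.

Definition mnmS := (@mnmDE n, @mnmBE n, mnm_indE).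

Lemma mcoeffXM p k (q : S) :
  mcoeff k (X p * q) = if p <=m k then mcoeff (k -m p) q else 0.
Proof.
rewrite -[X p * q]commr_mpolyX; case: ifPn => [le|nle].
  by rewrite -{1}(submK le) addmC mcoeffMX.
rewrite mcoeffM big1 // => -[k1 k2] /= /eqP ek; rewrite mcoeffX.
case: eqP => [e2|]; last by rewrite mulr0.
by case/negP: nle; rewrite ek e2 lem_addl.
Qed.

(** The truncation below degree [d] makes a polynomial out of an arbitrary family of
    coefficients. *)
Definition mpoly_of (d : nat) (c : multinom n -> K) : S :=
  \sum_(m : bmultinom n d) c m *: X m.

Lemma mcoeff_mpoly_of d c k :
  mcoeff k (mpoly_of d c) = if (mdeg k < d)%N then c k else 0.
Proof.
case: ifPn => [lt|]; first by rewrite mcoeff_mpoly.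
rewrite -leqNgt => le; rewrite raddf_sum big1 // => m _ /=.
rewrite mcoeffZ mcoeffX; case: eqP => [e|]; last by rewrite mulr0.
by move: le; rewrite -e leqNgt bmdeg.
Qed.

Lemma mcoeff_big_degree (q : S) k : (msize q <= mdeg k)%N -> mcoeff k q = 0.
Proof. by move=> le; apply: memN_msupp_eq0; apply: msize_mdeg_ge. Qed.

Lemma mdeg_ind F : (mdeg (mnm_ind F) <= n)%N.
Proof.
rewrite mdegE -[leqRHS]card_ord -sum1_card leq_sum // => i _.
by rewrite mnm_indE leq_b1.
Qed.

Section Ideal.
Variable D : {set {set 'I_n}}.
Hypothesis simplD : simplicial_complex D.

Lemma SR_idealP (q : S^o) :
  reflect (forall k, mnm_supp k \in D -> mcoeff k q = 0) (q \in SR_ideal D).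
Proof.
apply: (iffP idP) => [|h].
  pose M : {pred S^o} := fun q => `[< forall k, mnm_supp k \in D -> mcoeff k q = 0 >].
  move=> /asboolP/(_ M) hM; apply/asboolP; apply: hM => [|_ [F FD ->]].
    split=> [|r u v /asboolP Mu /asboolP Mv]; apply/asboolP => k kD.
      by rewrite mcoeff0.
    rewrite mcoeffD Mv // addr0 mcoeffM big1 // => -[k1 k2] /= /eqP ek.
    rewrite Mu ?mulr0 //; apply: simplD kD _; apply/fintype.subsetP => i.
    have -> : (i \in mnm_supp k) = (k1 i + k2 i != 0)%N by rewrite -mnmDE -ek inE.
    by rewrite inE addn_eq0 negb_and orbC => ->.
  apply/asboolP => k kD; rewrite sqfree_monE mcoeffX; case: eqP => // e.
  case/negP: FD; apply: simplD kD _; apply/fintype.subsetP => i iF.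
  by rewrite inE -e mnmE iF.
rewrite [q]mpolyE; apply: (@rpred_sum _ (SR_ideal D)) => k _.
have [kD|kD] := boolP (mnm_supp k \in D); first by rewrite h // scale0r rpred0.
rewrite -mul_mpolyC; apply: (@rpredZ _ _ (SR_ideal D)).
by apply/mpolyX_SR_ideal; exists (mnm_supp k).
Qed.

Local Notation Q := (quotmod (SR_ideal (K := K) D)).
Implicit Types (x y : Q).

(** Independent of the representative when the support of [k] is a face; these monomials form a
    basis of S/I. *)
Definition quot_coef k x : K := mcoeff k (repr x : S).

Lemma quot_coef_pi k (q : S^o) : mnm_supp k \in D ->
  quot_coef k (\pi_Q%qT q) = mcoeff k q.
Proof.
move=> kD; apply/eqP; rewrite -subr_eq0 -mcoeffB; apply/eqP.
apply: (elimT (SR_idealP _)) kD.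
by rewrite -pi_eq0 raddfB subr_eq0; apply/eqP; exact: reprK.
Qed.

Lemma quot_coefB k x y : mnm_supp k \in D ->
  quot_coef k (x - y) = quot_coef k x - quot_coef k y.
Proof.
elim/quotW: x => u; elim/quotW: y => v kD.
by rewrite -raddfB !quot_coef_pi //= mcoeffB.
Qed.

Lemma quot_coef0 k : mnm_supp k \in D -> quot_coef k 0 = 0.
Proof. by move=> kD; rewrite -[X in quot_coef k X](subrr 0) quot_coefB // subrr. Qed.

Lemma quot_coefD k x y : mnm_supp k \in D ->
  quot_coef k (x + y) = quot_coef k x + quot_coef k y.
Proof.
move=> kD; rewrite -[y in LHS]opprK quot_coefB // -[- y]add0r quot_coefB //.
by rewrite quot_coef0 // sub0r opprK.
Qed.

Lemma quot_coefX k p x : mnm_supp k \in D ->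
  quot_coef k (X p *: x) = if p <=m k then quot_coef (k -m p) x else 0.
Proof.
elim/quotW: x => u kD; rewrite scale_pi quot_coef_pi // mcoeffXM.
case: ifP => // _; rewrite quot_coef_pi //; apply: simplD kD _.
by apply/fintype.subsetP => i; rewrite !inE mnmBE; clear; lia.
Qed.

Lemma quot_coefC k (c : K) x : mnm_supp k \in D ->
  quot_coef k ((mpolyC n c : S) *: x) = c * quot_coef k x.
Proof.
by elim/quotW: x => u kD; rewrite scale_pi !quot_coef_pi // mcoeffCM.
Qed.

Lemma quot_coef_inj x y :
  (forall k, mnm_supp k \in D -> quot_coef k x = quot_coef k y) -> x = y.
Proof.
move=> h; apply/eqP; rewrite -subr_eq0; move: h.
elim/quotW: x => u; elim/quotW: y => v h.
rewrite -raddfB pi_eq0; apply/SR_idealP => k kD.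
by rewrite mcoeffB; have := h k kD; rewrite !quot_coef_pi // => ->; rewrite subrr.
Qed.

Local Notation A := (mingen_index D).
Local Notation free := (free_mod S A).
Local Notation gmap := (gen_map (@mingen K n D)).
Local Notation Syz := (Syz (@mingen K n D)).

Lemma mingenE (C : A) : mingen K C = X (mnm_ind (val C)).
Proof. exact: sqfree_monE. Qed.

Definition unit_gen C : free := [ffun C' : A => if val C' == C then 1 : S else 0].

Lemma gen_map_unit C : min_nonface D C -> gmap (unit_gen C) = X (mnm_ind C).
Proof.
move=> mC; rewrite gen_mapE (bigD1 (exist _ C mC : A)) //= ffunE eqxx mul1r big1.
  by rewrite addr0 mingenE.
move=> C' nC; rewrite ffunE ifN ?mul0r //; by apply: contraNneq nC => e; apply/eqP/val_inj.
Qed.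

Lemma monomial_gen m C : min_nonface D C -> mnm_ind C <=m m ->
  (X (m -m mnm_ind C) : S) * gmap (unit_gen C) = X m.
Proof. by move=> mC le; rewrite gen_map_unit // -mpolyXD submK. Qed.

(** The syzygy x^(m-C) e_C - x^(m-C') e_C' of multidegree [m], for [m] divisible by both
    generators. *)
Definition mon_syz m C C' : Syz :=
  pair_syz _ (X (m -m mnm_ind C) : S) (X (m -m mnm_ind C') : S) (unit_gen C) (unit_gen C').

Lemma mon_rel m C C' : min_nonface D C -> min_nonface D C' ->
  mnm_ind C <=m m -> mnm_ind C' <=m m ->
  (X (m -m mnm_ind C) : S) * gmap (unit_gen C) = (X (m -m mnm_ind C') : S) * gmap (unit_gen C').
Proof. by move=> mC mC' le le'; rewrite !monomial_gen. Qed.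

Lemma mon_syzE m C C' : min_nonface D C -> min_nonface D C' ->
  mnm_ind C <=m m -> mnm_ind C' <=m m ->
  val (mon_syz m C C') =
  (X (m -m mnm_ind C) : S) *: unit_gen C - (X (m -m mnm_ind C') : S) *: unit_gen C'.
Proof. by move=> mC mC' le le'; apply/pair_syzE/mon_rel. Qed.

Lemma mon_syz_shift m p C C' : min_nonface D C -> min_nonface D C' ->
  mnm_ind C <=m m -> mnm_ind C' <=m m ->
  mon_syz (m +m p) C C' = (X p : S) *: mon_syz m C C'.
Proof.
move=> mC mC' le le'; rewrite -pair_syz_scale; last exact: mon_rel.
have E F : mnm_ind F <=m m -> X (m +m p -m mnm_ind F) = X p * X (m -m mnm_ind F) :> S.
  move=> /mnm_lepP h; rewrite -mpolyXD; congr mpolyX; apply/mnmP => i.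
  by have := h i; rewrite !mnmS; clear; lia.
by rewrite /mon_syz !E.
Qed.

Lemma mon_syz_add m C C' C'' : min_nonface D C -> min_nonface D C' -> min_nonface D C'' ->
  mnm_ind C <=m m -> mnm_ind C' <=m m -> mnm_ind C'' <=m m ->
  mon_syz m C C' + mon_syz m C' C'' = mon_syz m C C''.
Proof. by move=> mC mC' mC'' le le' le''; apply: pair_syz_add; apply: mon_rel. Qed.

(** Dividing [m] by the product of both generators exhibits the cofactors as x^(m-C-C') times the
    opposite generator. *)
Lemma mon_syz_Kosz m C C' : min_nonface D C -> min_nonface D C' ->
  mnm_ind C +m mnm_ind C' <=m m -> mon_syz m C C' \in Kosz (g := @mingen K n D).
Proof.
move=> mC mC' /mnm_lepP le.
have e1 : X (m -m mnm_ind C -m mnm_ind C') * gmap (unit_gen C') = X (m -m mnm_ind C) :> S.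
  rewrite gen_map_unit // -mpolyXD; congr mpolyX; apply/mnmP => i.
  by have := le i; rewrite !mnmS; clear; lia.
have e2 : X (m -m mnm_ind C -m mnm_ind C') * gmap (unit_gen C) = X (m -m mnm_ind C') :> S.
  rewrite gen_map_unit // -mpolyXD; congr mpolyX; apply/mnmP => i.
  by have := le i; rewrite !mnmS; clear; lia.
rewrite /mon_syz -e1 -e2; exact: pair_syz_Kosz.
Qed.

Lemma syz_coef (s : Syz) m :
  \sum_(C : A | mnm_ind (val C) <=m m) mcoeff (m -m mnm_ind (val C)) (val s C : S) = 0.
Proof.
have : gmap (val s) = 0 by apply/eqP; case: s.
rewrite gen_mapE => /(congr1 (fun q : S => mcoeff m q)).
rewrite mcoeff0 raddf_sum /= => e0; rewrite -[RHS]e0 big_mkcond; apply: eq_bigr => C _.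
by rewrite mulrC mingenE mcoeffXM.
Qed.

(** * From cocycles to homomorphisms *)

Section Extension.
Variables (a b : {set 'I_n}) (nu : {set 'I_n} -> {set 'I_n} -> K).
Hypothesis ab : [disjoint a & b].
Hypothesis nu_cocycle : cocycle_over D a b nu.

Local Notation src l := (l -m mnm_ind a +m mnm_ind b).

(* Coefficient at l of the image of u under the map of degree a - b taking the term
   x^(m - C) e_C to nu F C x^(m + a - b), where F is the support of the target off b. This
   map is linear on syzygies, but not on the free module. *)
Definition ext_coef (u : free) l : K :=
  if mnm_ind a <=m l then
    \sum_(C : A | mnm_ind (val C) <=m src l)
      nu (mnm_supp l :\: b) (val C) * mcoeff (src l -m mnm_ind (val C)) (u C : S)
  else 0.

Lemma ext_over l : mnm_supp l \in D -> mnm_ind a <=m l ->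
  mnm_supp l :\: b \in faces_over D a b.
Proof.
move=> lD /mnm_lepP al; apply/faces_overP; split.
- by apply: simplD lD _; apply: finset.subsetDl.
- apply/fintype.subsetP => i ia; have := al i; rewrite !inE mnm_indE ia.
  by rewrite (disjointFr ab ia) /=; clear; lia.
- by move=> i; rewrite inE => /andP[].
Qed.

Lemma ext_gen l m (C : A) : m <=m src l -> mnm_ind (val C) <=m m ->
  val C \in gens_in D b (mnm_supp l :\: b).
Proof.
move=> /mnm_lepP ml /mnm_lepP Cm; apply/gens_inP; split; first exact: valP.
apply/fintype.subsetP => i iC; have := Cm i; have := ml i.
rewrite !inE !mnmS iC; case: (i \in b) => //=; clear; lia.
Qed.

(** Multiplying by x^p replaces the target [l] by [l -m p], hence its face by a smaller one. By the
    cocycle condition the values at the two faces differ by a constant, which is killed because the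
    coefficients of a syzygy sum to zero in each degree. *)
Lemma ext_coefX (s : Syz) p l : mnm_supp l \in D ->
  ext_coef ((X p : S) *: val s) l = if p <=m l then ext_coef (val s) (l -m p) else 0.
Proof.
move=> lD; rewrite /ext_coef; have [al|nal] := boolP (mnm_ind a <=m l); last first.
  case: ifP => // _; case: ifP => // h; case/negP: nal.
  by apply: lepm_trans h _; apply: lem_subr.
have oF := ext_over lD al.
have [pm|npm] := boolP (p <=m src l); last first.
  rewrite big1 => [|C _].
    case: ifP => // pl; case: ifP => // apl; case/negP: npm; apply/mnm_lepP => i.
    by move/mnm_lepP/(_ i): apl; move/mnm_lepP/(_ i): pl; rewrite !mnmS; clear; lia.
  rewrite ffunE mcoeffXM ifN ?mulr0 //; apply: contra npm => h.
  by apply: lepm_trans h _; apply: lem_subr.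
pose m := src l -m p.
have lhs : \sum_(C : A | mnm_ind (val C) <=m src l)
      nu (mnm_supp l :\: b) (val C) *
      mcoeff (src l -m mnm_ind (val C)) (((X p : S) *: val s) C : S) =
    \sum_(C : A | mnm_ind (val C) <=m m)
      nu (mnm_supp l :\: b) (val C) * mcoeff (m -m mnm_ind (val C)) (val s C : S).
  rewrite big_mkcond [RHS]big_mkcond; apply: eq_bigr => C _.
  rewrite ffunE mcoeffXM.
  have -> : (mnm_ind (val C) <=m m) =
      (mnm_ind (val C) <=m src l) && (p <=m src l -m mnm_ind (val C)).
    apply/mnm_lepP/andP => [h | [/mnm_lepP h1 /mnm_lepP h2] i].
      split; apply/mnm_lepP => i; have := h i; move/mnm_lepP/(_ i): pm;
      by rewrite !mnmS; clear; lia.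
    by have := h1 i; have := h2 i; rewrite !mnmS; clear; lia.
  case: ifP => //= _; case: ifP => //= _; last by rewrite mulr0.
  congr (_ * mcoeff _ _); apply/mnmP => i; rewrite !mnmS; clear; lia.
rewrite lhs.
have mlel : m <=m src l by apply: lem_subr.
(* If b does not divide [m], the generators dividing [m] do not contain b, so their values vanish;
   on the other side [l -m p] is not a legitimate target. *)
have [bm|nbm] := boolP (mnm_ind b <=m m); last first.
  rewrite big1 => [|C Cm].
    case: ifP => // pl; case: ifP => // apl; case/negP: nbm; apply/mnm_lepP => i.
    by move/mnm_lepP/(_ i): apl; move/mnm_lepP/(_ i): pl; rewrite !mnmS; clear; lia.
  rewrite (nu_cocycle.1 _ _ oF (ext_gen mlel Cm)) ?mul0r //.
  apply: contra nbm => /fintype.subsetP bC; apply: lepm_trans Cm; apply/mnm_lepP => i.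
  by rewrite !mnm_indE; case: (boolP (i \in b)) => // /bC->.
have pl_apl i : (p i <= l i)%N /\ (mnm_ind a i <= l i - p i)%N.
  move/mnm_lepP/(_ i): bm; move/mnm_lepP/(_ i): pm; move/mnm_lepP/(_ i): al.
  have : ~~ ((i \in a) && (i \in b)).
    by case: (boolP (i \in a)) => // /(disjointFr ab) ->.
  by rewrite !mnmS; clear; lia.
have pl : p <=m l by apply/mnm_lepP => i; have [] := pl_apl i.
have apl : mnm_ind a <=m l -m p by apply/mnm_lepP => i; rewrite mnmBE; have [] := pl_apl i.
rewrite pl apl.
have srcE : src (l -m p) = m.
  by apply/mnmP => i; have [] := pl_apl i; rewrite !mnmS; clear; lia.
rewrite srcE; pose F := mnm_supp l :\: b; pose G := mnm_supp (l -m p) :\: b.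
have sl : mnm_supp (l -m p) \subset mnm_supp l.
  by apply/fintype.subsetP => i; rewrite !inE mnmBE; clear; lia.
have oG : G \in faces_over D a b by apply: ext_over apl; apply: simplD lD sl.
have GF : G \subset F by apply: finset.setSD.
have [C0 C0m|none] := pickP (fun C : A => mnm_ind (val C) <=m m); last first.
  by rewrite !big_pred0.
apply/eqP; rewrite -subr_eq0 -sumrB; apply/eqP.
transitivity ((nu F (val C0) - nu G (val C0)) *
    \sum_(C : A | mnm_ind (val C) <=m m) mcoeff (m -m mnm_ind (val C)) (val s C : S)); last first.
  by rewrite syz_coef mulr0.
rewrite mulr_sumr; apply: eq_bigr => C Cm; rewrite -mulrBl; congr (_ * _).
have gG (C1 : A) : mnm_ind (val C1) <=m m -> val C1 \in gens_in D b G.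
  by move=> h; apply: (@ext_gen _ m); rewrite ?srcE ?lepm_refl.
have e := nu_cocycle.2 _ _ _ _ oG oF GF (gG _ Cm) (gG _ C0m).
apply/eqP; rewrite -subr_eq0 opprB [nu G _ - nu F _]addrC addrACA -e.
by rewrite addrACA subrr add0r addNr.
Qed.

Lemma ext_coefD (u v : free) l : ext_coef (u + v) l = ext_coef u l + ext_coef v l.
Proof.
rewrite /ext_coef; case: ifP => _; last by rewrite addr0.
rewrite -big_split /=; apply: eq_bigr => C _ /=.
by rewrite ffunE mcoeffD mulrDr.
Qed.

Lemma ext_coefC (c : K) (u : free) l :
  ext_coef ((mpolyC n c : S) *: u) l = c * ext_coef u l.
Proof.
rewrite /ext_coef; case: ifP => _; last by rewrite mulr0.
rewrite mulr_sumr; apply: eq_bigr => C _.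
by rewrite ffunE mcoeffCM mulrCA.
Qed.

Lemma ext_coef_Kosz (u v : free) l : mnm_supp l \in D ->
  ext_coef ((gmap u : S) *: v - (gmap v : S) *: u) l = 0.
Proof.
move=> lD; rewrite /ext_coef; case: ifP => // al.
have oF := ext_over lD al; set F := _ :\: b; set m := src l.
have expand (x y : free) (C : A) : mnm_ind (val C) <=m m ->
    mcoeff (m -m mnm_ind (val C)) ((gmap x : S) * y C) =
    \sum_(C' : A | mnm_ind (val C) +m mnm_ind (val C') <=m m)
      mcoeff (m -m mnm_ind (val C) -m mnm_ind (val C')) ((x C' : S) * y C).
  move=> /mnm_lepP Cm; rewrite gen_mapE mulr_suml raddf_sum [RHS]big_mkcond.
  apply: eq_bigr => C' _ /=; rewrite mulrAC mulrC mingenE mcoeffXM.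
  congr (if _ then _ else _); apply/mnm_lepP/mnm_lepP => h i; have := h i; have := Cm i;
  by rewrite !mnmS /=; clear; lia.
have gF (C C' : A) : mnm_ind (val C) +m mnm_ind (val C') <=m m -> val C \in gens_in D b F.
  by move=> h; apply: (ext_gen h); apply: lem_addr.
(* If b were contained in C, then C + C' <= m would force the support of the target
   monomial l to contain the nonface C'. *)
have not_sup (C C' : A) : mnm_ind (val C) +m mnm_ind (val C') <=m m -> ~~ (b \subset val C).
  move=> /mnm_lepP h; apply/negP => /fintype.subsetP bC.
  have C'l : val C' \subset mnm_supp l.
    apply/fintype.subsetP => i iC'; have := h i; rewrite inE !mnmS iC'.
    by case: (boolP (i \in b)) => [/bC ->|_] /=; clear; lia.
  by have /andP[/negP] := valP C'; case; apply: simplD lD C'l.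
have nu0 (C C' : A) : mnm_ind (val C) +m mnm_ind (val C') <=m m -> nu F (val C) = 0.
  by move=> h; apply: (nu_cocycle.1 _ _ oF (gF _ _ h) (not_sup _ _ h)).
apply: big1 => C Cm.
have -> : ((gmap u : S) *: v - (gmap v : S) *: u) C = (gmap u : S) * v C - (gmap v : S) * u C.
  by rewrite !ffunE.
rewrite mcoeffB !expand // mulrBr !mulr_sumr !big1 ?subrr // => C' h;
by rewrite (nu0 _ _ h) mul0r.
Qed.

Lemma leq_mdeg m p : m <=m p -> (mdeg m <= mdeg p)%N.
Proof. by move=> /submK <-; rewrite mdegD leq_addl. Qed.

(** A target [l] exceeds the degree of a term of [u] by at most the degrees of a generator and of
    [a], both squarefree, hence the two summands [n]. *)
Definition ext_bound (u : free) : nat := (\sum_(C : A) msize (u C : S) + n + n)%N.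

Lemma ext_coef_bound u l : (ext_bound u <= mdeg l)%N -> ext_coef u l = 0.
Proof.
move=> le; rewrite /ext_coef; case: ifP => // _; apply: big1 => C _.
rewrite mcoeff_big_degree ?mulr0 //.
have hl : l <=m (src l -m mnm_ind (val C)) +m mnm_ind a +m mnm_ind (val C).
  by apply/mnm_lepP => i; rewrite !mnmS; clear; lia.
have := leq_trans le (leq_mdeg hl); rewrite !mdegD /ext_bound (bigD1 C) //=.
have := mdeg_ind a; have := mdeg_ind (val C); rewrite /=; clear; lia.
Qed.

Definition ext_fun (s : Syz) : Q :=
  \pi_Q%qT (mpoly_of (ext_bound (val s)) (ext_coef (val s)) : S^o).

Lemma quot_coef_ext s l : mnm_supp l \in D ->
  quot_coef l (ext_fun s) = ext_coef (val s) l.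
Proof.
move=> lD; rewrite quot_coef_pi // mcoeff_mpoly_of; case: ifPn => //.
by rewrite -leqNgt => /ext_coef_bound->.
Qed.

Lemma ext_funD s s' : ext_fun (s + s') = ext_fun s + ext_fun s'.
Proof.
apply: quot_coef_inj => l lD.
by rewrite quot_coefD // !quot_coef_ext // raddfD /= ext_coefD.
Qed.

Lemma ext_funZ (r : S) s : ext_fun (r *: s) = r *: ext_fun s.
Proof.
elim/mpolyind: r => [|c m r _ _ IH] in s *.
  rewrite !scale0r; apply: quot_coef_inj => l lD.
  have -> : ext_fun 0 = ext_fun (0 + 0) - ext_fun 0 by rewrite ext_funD addrK.
  by rewrite addr0 subrr.
rewrite !scalerDl ext_funD {}IH; congr (_ + _).
rewrite -mul_mpolyC -!scalerA; apply: quot_coef_inj => l lD.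
rewrite quot_coefC // quot_coefX // quot_coef_ext // !linearZ /= ext_coefC.
congr (_ * _); rewrite ext_coefX //; case: ifP => // ml.
rewrite quot_coef_ext //; apply: simplD lD _.
by apply/fintype.subsetP => i; rewrite !inE mnmBE; clear; lia.
Qed.

Fact ext_linear : linear ext_fun.
Proof. by move=> r u v; rewrite ext_funD ext_funZ. Qed.

Definition ext : {linear Syz -> Q} :=
  HB.pack ext_fun (GRing.isLinear.Build S Syz Q _ ext_fun ext_linear).

Lemma ext_Kosz s : s \in Kosz (g := @mingen K n D) -> ext s = 0.
Proof.
apply: (span_ker (f := ext)) => {}s [u [v Es]].
apply: quot_coef_inj => l lD; rewrite quot_coef0 // quot_coef_ext //.
by rewrite Es ext_coef_Kosz.
Qed.

Lemma ext_coefB (u v : free) l : ext_coef (u - v) l = ext_coef u l - ext_coef v l.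
Proof.
rewrite /ext_coef; case: ifP => _; last by rewrite subr0.
rewrite -sumrB; apply: eq_bigr => C _.
by rewrite free_subE mcoeffB mulrBr.
Qed.

Lemma ext_coef_unit l C : mnm_ind a <=m l -> min_nonface D C -> mnm_ind C <=m src l ->
  ext_coef ((X (src l -m mnm_ind C) : S) *: unit_gen C) l = nu (mnm_supp l :\: b) C.
Proof.
move=> al mC Cl; rewrite /ext_coef al (bigD1 (exist _ C mC : A)) //= free_scaleE ffunE eqxx mulr1.
rewrite mcoeffX eqxx mulr1 big1 ?addr0 // => C' /andP[_ nC].
by rewrite free_scaleE ffunE ifN ?mulr0 ?mcoeff0 ?mulr0.
Qed.

(** The constant [mu C] is the coefficient of [h] at the basis vector of [C] in degree a - b.
    Evaluating both maps on the syzygy between [C] and [C'] of multidegree [mnm_ind (F :|: b)] gives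
    the coboundary equation. *)
Lemma ext_coboundary (h : {linear free -> Q}) :
  (forall s : Syz, ext s = h (val s)) -> coboundary_over D a b nu.
Proof.
move=> eh.
exists (fun C => if b \subset C then
  quot_coef (mnm_ind C +m mnm_ind a -m mnm_ind b) (h (unit_gen C)) else 0).
split=> [C /negPf-> // | F C C' oF gC gC'].
have [FD aF Fb] := faces_overP _ _ _ _ oF.
(* The target has support exactly F, with exponent 2 on [a], so that its source exponent is the
   indicator of F and b. *)
pose l := mnm_ind F +m mnm_ind a.
have Fa i : (i \in a) -> (i \in F) := fintype.subsetP aF i.
have Fbi i : (i \in F) && (i \in b) = false.
  by apply/negP => /andP[/Fb/negP].
have sl : mnm_supp l = F.
  apply/finset.setP => i; rewrite inE !mnmS; have := Fa i.
  by case: (i \in F); case: (i \in a) => //= /(_ isT).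
have sF : mnm_supp l :\: b = F.
  by apply/finset.setP => i; rewrite sl inE andbC; have := Fbi i; case: (i \in F) => //= ->.
have lD : mnm_supp l \in D by rewrite sl.
have al : mnm_ind a <=m l by apply: lem_addl.
have srcE : src l = mnm_ind (F :|: b).
  apply/mnmP => i; rewrite !mnmS inE; have := Fbi i.
  by case: (i \in F); case: (i \in b) => //=; clear; lia.
have gen_le C1 : C1 \in gens_in D b F -> mnm_ind C1 <=m src l.
  move=> /gens_inP[_ sC]; rewrite srcE; apply/mnm_lepP => i; rewrite !mnm_indE.
  by case: (boolP (i \in C1)) => // /(fintype.subsetP sC) ->.
have [mC mC'] : min_nonface D C /\ min_nonface D C'.
  by move: gC gC' => /gens_inP[-> _] /gens_inP[-> _].
have key C1 : C1 \in gens_in D b F ->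
    quot_coef l ((X (src l -m mnm_ind C1) : S) *: h (unit_gen C1)) =
    if b \subset C1 then
      quot_coef (mnm_ind C1 +m mnm_ind a -m mnm_ind b) (h (unit_gen C1)) else 0.
  move=> gC1; have /mnm_lepP lC := gen_le _ gC1; rewrite quot_coefX //.
  have ai i : (i \in a) && (i \in b) = false.
    by apply/negP => /andP[/Fa/Fb/negP].
  have -> : (src l -m mnm_ind C1 <=m l) = (b \subset C1).
    rewrite srcE; apply/mnm_lepP/fintype.subsetP => [h1 i ib | h1 i].
      have := h1 i; have := Fbi i; have := ai i; rewrite !mnmS inE ib /= !andbT => -> ->.
      by case: (i \in C1).
    rewrite !mnmS inE; case: (boolP (i \in b)) => [/h1 ->|_]; rewrite ?orbT ?orbF /=;
    by case: (i \in F); case: (i \in C1); case: (i \in a).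
  case: ifP => // /fintype.subsetP bC; congr (quot_coef _ _); apply/mnmP => i.
  have := lC i; rewrite srcE; have := Fbi i; have := ai i; have := bC i; have := Fa i.
  rewrite !mnmS inE.
  case: (i \in b); case: (i \in F); case: (i \in a); case: (i \in C1) => //=;
  by move=> H1 H2; try (by have := H1 isT); try (by have := H2 isT).
have eqh : h (val (mon_syz (src l) C C')) =
    (X (src l -m mnm_ind C) : S) *: h (unit_gen C) -
    (X (src l -m mnm_ind C') : S) *: h (unit_gen C').
  rewrite (mon_syzE mC mC' (gen_le _ gC) (gen_le _ gC')).
  exact: linear_pair.
rewrite -(key _ gC) -(key _ gC') -quot_coefB // -eqh -eh quot_coef_ext //.
rewrite (mon_syzE mC mC' (gen_le _ gC) (gen_le _ gC')) ext_coefB.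
rewrite -sF; apply/esym; congr (_ - _).
  exact: (ext_coef_unit al mC (gen_le _ gC)).
exact: (ext_coef_unit al mC' (gen_le _ gC')).
Qed.

End Extension.

Theorem T2_vanishes_H1 : T2_vanishes K D -> forall a b, H1_trivial D K a b.
Proof.
move=> T0 a b nu cnu.
have [ab|nab] := boolP [disjoint a & b].
  have [h eh] := (T2_trivialP (@mingen_SR_ideal K n D)).1 T0 _ (@ext_Kosz a b nu ab cnu).
  exact: ext_coboundary eh.
exists (fun=> 0); split=> // F C C' /faces_overP[_ /fintype.subsetP aF Fb].
by case/negP: nab; rewrite disjoint_subset; apply/fintype.subsetP => i /aF/Fb.
Qed.

(** * Generation of the syzygies by pairs of generators *)

Lemma mon_syz_coef m k C1 C2 (C : A) : min_nonface D C1 -> min_nonface D C2 ->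
  mnm_ind C1 <=m m -> mnm_ind C2 <=m m ->
  mcoeff k (val (mon_syz m C1 C2) C : S) =
  ((val C == C1) && (m -m mnm_ind C1 == k))%:R - ((val C == C2) && (m -m mnm_ind C2 == k))%:R.
Proof.
move=> m1 m2 l1 l2; rewrite (mon_syzE m1 m2 l1 l2) free_pairE mcoeffB /unit_gen ffunE ffunE.
by congr (_ - _); case: ifP => _; rewrite ?mulr1 ?mulr0 ?mcoeffX ?mcoeff0.
Qed.

(** In each multidegree all terms are compared with one pivot generator; the pivot terms add up to
    zero because [s] is a syzygy. *)
Lemma syz_decomposition (s : Syz) (pivot : multinom n -> A) d :
  (forall m (C : A), mnm_ind (val C) <=m m -> mnm_ind (val (pivot m)) <=m m) ->
  (\sum_(C : A) msize (val s C : S) + n <= d)%N ->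
  s = \sum_(m : bmultinom n d) \sum_(C : A | mnm_ind (val C) <=m m)
    (mpolyC n (mcoeff (m -m mnm_ind (val C)) (val s C : S)) : S) *:
      mon_syz m (val C) (val (pivot m)).
Proof.
move=> piv le; apply: val_inj; apply/ffunP => C; apply/mpolyP => k.
rewrite syz_sumE raddf_sum /=.
pose c (m : multinom n) (C' : A) : K := mcoeff (m -m mnm_ind (val C')) (val s C' : S).
transitivity (\sum_(m : bmultinom n d | mnm_ind (val C) <=m m)
    (if m -m mnm_ind (val C) == k then c m C else 0)); last first.
  rewrite big_mkcond; apply: eq_bigr => m _; rewrite syz_sumE raddf_sum /=.
  transitivity (\sum_(C' : A | mnm_ind (val C') <=m m)
      (c m C' * ((val C == val C') && (m -m mnm_ind (val C') == k))%:R -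
       c m C' * ((val C == val (pivot m)) && (m -m mnm_ind (val (pivot m)) == k))%:R)).
    rewrite sumrB -mulr_suml syz_coef mul0r subr0.
    have [Cm|nCm] := boolP (mnm_ind (val C) <=m m).
      rewrite (bigD1 C) //= eqxx big1 ?addr0 => [|C' /andP[_ nC]].
        by case: ifP => _; rewrite ?mulr1 ?mulr0.
      have /negPf-> : val C != val C' by rewrite eq_sym; exact: nC.
      by rewrite mulr0.
    rewrite big1 // => C' C'm; case: eqP => [e|]; rewrite ?mulr0 //.
    by case/negP: nCm; rewrite e.
  apply: eq_bigr => C' C'm; rewrite syz_scaleE mcoeffCM -mulrBr; congr (_ * _).
  by rewrite mon_syz_coef ?(valP C') ?(valP (pivot m)) // (piv _ _ C'm).
have [lt|ge] := ltnP (mdeg (k +m mnm_ind (val C))) d.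
  rewrite (bigD1 (BMultinom lt)) /=; last exact: lem_addl.
  rewrite /c addmK eqxx big1 ?addr0 // => m /andP[Cm nm].
  case: eqP => // e; case/negP: nm; apply/eqP/val_inj => /=.
  by rewrite -e submK.
rewrite big1 => [|m Cm].
  apply: mcoeff_big_degree; move: (leq_trans le ge); rewrite mdegD (bigD1 C) //=.
  by have := mdeg_ind (val C); rewrite /=; clear; lia.
by case: eqP => // e; move: ge; rewrite -e submK // leqNgt bmdeg.
Qed.

(** Every [mon_syz] is a monomial multiple of the one at the lcm, which for squarefree generators is
    the indicator of the union. *)
Lemma syz_generated (V : lmodType S) (psi : {linear Syz -> V}) :
  (forall C C' : A, psi (mon_syz (mnm_ind (val C :|: val C')) (val C) (val C')) = 0) ->
  forall s, psi s = 0.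
Proof.
move=> psi0 s.
have psi_mon m (C C' : A) : mnm_ind (val C) <=m m -> mnm_ind (val C') <=m m ->
    psi (mon_syz m (val C) (val C')) = 0.
  move=> /mnm_lepP lC /mnm_lepP lC'; pose m0 := mnm_ind (val C :|: val C').
  have -> : m = m0 +m (m -m m0).
    apply/mnmP => i; have := lC i; have := lC' i; rewrite !mnmS inE.
    by case: (i \in val C); case: (i \in val C') => /=; clear; lia.
  have le (C1 : A) : val C1 \subset val C :|: val C' -> mnm_ind (val C1) <=m m0.
    move=> sC; apply/mnm_lepP => i; rewrite !mnm_indE.
    by case: (boolP (i \in val C1)) => // /(fintype.subsetP sC) ->.
  rewrite mon_syz_shift ?(valP C) ?(valP C') ?le ?finset.subsetUl ?finset.subsetUr //.
  by rewrite linear_scale psi0 scaler0.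
have [C0 _|noC] := pickP (fun _ : A => true); last first.
  suff -> : s = 0 by rewrite linear0.
  by apply: val_inj; apply/ffunP => C; have := noC C.
pose pivot m : A := odflt C0 [pick C : A | mnm_ind (val C) <=m m].
have piv m (C : A) : mnm_ind (val C) <=m m -> mnm_ind (val (pivot m)) <=m m.
  by move=> Cm; rewrite /pivot; case: pickP => [C1|/(_ C)] //=; rewrite Cm.
rewrite [X in psi X](syz_decomposition (s := s) piv (leqnn _)) raddf_sum big1 // => m _.
rewrite raddf_sum big1 // => C Cm.
by rewrite /= linear_scale (psi_mon _ _ _ Cm (piv _ _ Cm)) scaler0.
Qed.

(** * From vanishing cohomology to extensions of homomorphisms *)

Section Solve.
Hypothesis H1 : forall a b, H1_trivial D K a b.
Variable f : {linear Syz -> Q}.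
Hypothesis f_Kosz : forall s : Syz, s \in Kosz (g := @mingen K n D) -> f s = 0.

Definition pair_coef m k C C' : K := quot_coef k (f (mon_syz m C C')).

Lemma pair_coef_shift m k p C C' : min_nonface D C -> min_nonface D C' ->
  mnm_ind C <=m m -> mnm_ind C' <=m m -> mnm_supp (k +m p) \in D ->
  pair_coef (m +m p) (k +m p) C C' = pair_coef m k C C'.
Proof.
move=> mC mC' l l' kD; rewrite /pair_coef mon_syz_shift // linear_scale quot_coefX //.
by rewrite lem_addl addmK.
Qed.

Lemma pair_coef_eq0 m k p C C' : min_nonface D C -> min_nonface D C' ->
  mnm_ind C <=m m -> mnm_ind C' <=m m -> mnm_supp k \in D -> ~~ (p <=m k) ->
  pair_coef (m +m p) k C C' = 0.
Proof.
move=> mC mC' l l' kD npk; rewrite /pair_coef mon_syz_shift // linear_scale quot_coefX //.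
by rewrite (negPf npk).
Qed.

Lemma pair_coef_add m k C C' C'' :
  min_nonface D C -> min_nonface D C' -> min_nonface D C'' ->
  mnm_ind C <=m m -> mnm_ind C' <=m m -> mnm_ind C'' <=m m -> mnm_supp k \in D ->
  pair_coef m k C C' + pair_coef m k C' C'' = pair_coef m k C C''.
Proof.
move=> mC mC' mC'' l l' l'' kD.
by rewrite /pair_coef -quot_coefD // -raddfD mon_syz_add.
Qed.

Lemma pair_coef_Kosz m k C C' : min_nonface D C -> min_nonface D C' ->
  mnm_ind C +m mnm_ind C' <=m m -> mnm_supp k \in D -> pair_coef m k C C' = 0.
Proof.
by move=> mC mC' l kD; rewrite /pair_coef (f_Kosz (mon_syz_Kosz mC mC' l)) quot_coef0.
Qed.

(* The component of f of multidegree e - (1, ..., 1); multidegrees with an entry below -1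
   do not occur, since the lcm of two generators is squarefree. *)
Section Degree.
Variable e : multinom n.
Let b : {set 'I_n} := [set i | e i == 0%N].
Let a : {set 'I_n} := [set i | (1 < e i)%N].
Local Notation pos F := (mnm_ind (F :|: b)).
Local Notation tgt F := (pos F +m e -m mnm_ind [set: 'I_n]).

Let in_b i : (i \in b) = (e i == 0%N). Proof. by rewrite inE. Qed.
Let in_a i : (i \in a) = (1 < e i)%N. Proof. by rewrite inE. Qed.

(** The exponent of [tgt F] is [e i] on F, which is positive there, and 0 on [b]. Elsewhere
    [e i = 1], since F contains [a], so the exponent is again 0. *)
Lemma tgt_supp F : F \in faces_over D a b -> mnm_supp (tgt F) = F.
Proof.
move=> /faces_overP[_ /fintype.subsetP aF Fb]; apply/finset.setP => i.
have h1 := aF i; have h2 := Fb i; rewrite in_a in h1; rewrite in_b in h2.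
rewrite inE !mnmS !inE; move: (e i) h1 h2 => x.
case: (i \in F) => /= [_ /(_ isT)|h _]; first by case: x.
by case: x h => [|[|x]] // /(_ isT).
Qed.

Lemma gen_le_pos F C : C \in gens_in D b F -> mnm_ind C <=m pos F.
Proof.
move=> /gens_inP[_ sC]; apply/mnm_lepP => i; rewrite !mnm_indE.
by case: (boolP (i \in C)) => // /(fintype.subsetP sC) ->.
Qed.

Lemma gen_min b' F C : C \in gens_in D b' F -> min_nonface D C.
Proof. by case/gens_inP. Qed.

Lemma tgtD F : F \in faces_over D a b -> mnm_supp (tgt F) \in D.
Proof. by move=> oF; rewrite tgt_supp //; case/faces_overP: oF. Qed.

Definition deg_coef F C C' : K := pair_coef (pos F) (tgt F) C C'.

Lemma deg_coef_add F C C' C'' : F \in faces_over D a b ->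
  C \in gens_in D b F -> C' \in gens_in D b F -> C'' \in gens_in D b F ->
  deg_coef F C C' + deg_coef F C' C'' = deg_coef F C C''.
Proof.
move=> oF gC gC' gC''; have [m1 m2 m3] := And3 (gen_min gC) (gen_min gC') (gen_min gC'').
by apply: pair_coef_add; rewrite ?gen_le_pos ?tgtD.
Qed.

Lemma deg_coef_mono F (G C C' : {set 'I_n}) : F \in faces_over D a b ->
  G \in faces_over D a b -> F \subset G ->
  C \in gens_in D b F -> C' \in gens_in D b F -> deg_coef F C C' = deg_coef G C C'.
Proof.
move=> oF oG /fintype.subsetP FG gC gC'; pose p := pos G -m pos F.
have eG : pos G = pos F +m p.
  apply/mnmP => i; have := FG i; rewrite !mnmS !inE.
  by case: (i \in F) => [/(_ isT)->|_] //=; case: (i \in G); case: (e i == 0%N).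
have et : tgt G = tgt F +m p.
  apply/mnmP => i; have := FG i; rewrite !mnmS !inE.
  case: (i \in F) => [/(_ isT)->|_] /=; rewrite ?subnn ?addn0 //.
  case: (eqVneq (e i) 0%N) => [->|]; rewrite ?orbT ?orbF; first by case: (i \in G).
  by case: (i \in G) => /=; clear; lia.
rewrite /deg_coef et eG pair_coef_shift ?gen_le_pos ?(gen_min gC) ?(gen_min gC') //.
by rewrite -et tgtD.
Qed.

(** If both generators miss some [i] of [b], the syzygy is a multiple of x_i, while the target has
    exponent 0 at [i]. *)
Lemma deg_coef_partial F C C' : F \in faces_over D a b ->
  C \in gens_in D b F -> C' \in gens_in D b F -> ~~ (b \subset C :|: C') ->
  deg_coef F C C' = 0.
Proof.
move=> oF gC gC' /subsetPn[i ib]; rewrite inE negb_or => /andP[iC iC'].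
have iF : i \notin F by have [_ _ Fb] := faces_overP _ _ _ _ oF; apply: contraL ib; apply: Fb.
pose m := pos F -m mnm1 i.
have em : pos F = m +m mnm1 i.
  by rewrite submK // lep1mP mnm_indE inE ib orbT.
have le C1 : C1 \in gens_in D b F -> i \notin C1 -> mnm_ind C1 <=m m.
  move=> /gen_le_pos/mnm_lepP l iC1; apply/mnm_lepP => j; have := l j.
  rewrite mnmBE mnm1E !mnm_indE; case: eqVneq => [<-|_]; last by rewrite subn0.
  by rewrite (negPf iC1).
rewrite /deg_coef {1}em pair_coef_eq0 ?le ?tgtD ?(gen_min gC) ?(gen_min gC') //.
apply/negP => /mnm_lepP/(_ i); rewrite mnm1E eqxx !mnmS !inE.
by move: ib; rewrite in_b => /eqP->; rewrite orbT.
Qed.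

(* If the union of F and C :&: C' is a face, then multiplying the syzygy by the monomial of
   C :&: C' makes it a Koszul relation without losing the coefficient. Otherwise C and C'
   can both be compared with a generator contained in this union. *)
Lemma deg_coef_based F C C' : F \in faces_over D a b ->
  C \in gens_in D b F -> C' \in gens_in D b F -> ~~ (b \subset C) -> ~~ (b \subset C') ->
  deg_coef F C C' = 0.
Proof.
move=> oF gC gC' nC nC'; have [FD aF Fb] := faces_overP _ _ _ _ oF.
have [sC sC'] : C \subset F :|: b /\ C' \subset F :|: b.
  by split; [case/gens_inP: gC|case/gens_inP: gC'].
have [UD|UD] := boolP (F :|: C :&: C' \in D).
  pose p := mnm_ind (C :&: C').
  have sp : mnm_supp (tgt F +m p) = F :|: C :&: C'.
    apply/finset.setP => i; have := congr1 (fun A : {set _} => i \in A) (tgt_supp oF).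
    rewrite !inE mnmDE mnm_indE inE addn_eq0 negb_and => ->.
    by case: (_ && _).
  rewrite /deg_coef -(pair_coef_shift (p := p)) ?gen_le_pos ?(gen_min gC) ?(gen_min gC') ?sp //.
  apply: pair_coef_Kosz; rewrite ?(gen_min gC) ?(gen_min gC') ?sp //.
  apply/mnm_lepP => i; have := fintype.subsetP sC i; have := fintype.subsetP sC' i.
  rewrite !mnmDE !mnm_indE (finset.in_setI i C C').
  case: (i \in C); case: (i \in C'); case: (i \in F :|: b) => //= h h'.
  - by have := h isT.
  - by have := h' isT.
  - by have := h isT.
have sU : F :|: C :&: C' \subset F :|: b.
  apply/fintype.subsetP => i; rewrite !inE => /orP[->//|/andP[/(fintype.subsetP sC)]].
  by rewrite !inE.
have [C1 gC1 sC1] := nonface_gen UD sU.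
have partial C2 : C :&: C' \subset C2 -> ~~ (b \subset C2) -> ~~ (b \subset C2 :|: C1).
  move=> sC2 /subsetPn[i ib iC2]; apply/subsetPn; exists i; rewrite // inE (negPf iC2) /=.
  apply/negP => /(fintype.subsetP sC1); rewrite inE => /orP[/Fb|/(fintype.subsetP sC2)].
    by rewrite ib.
  by rewrite (negPf iC2).
rewrite -(deg_coef_add oF gC gC1 gC') deg_coef_partial ?partial ?finset.subsetIl //.
by rewrite add0r deg_coef_partial // finset.setUC partial ?finset.subsetIr.
Qed.

(** A reference generator, chosen without [b] whenever possible; coefficients relative to it then
    satisfy the normalization. *)
Definition base_gen F : {set 'I_n} :=
  if [pick C in gens_in D b F | ~~ (b \subset C)] is Some C then C
  else odflt finset.set0 [pick C in gens_in D b F].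

Lemma base_genP F C : C \in gens_in D b F ->
  base_gen F \in gens_in D b F /\ (~~ (b \subset C) -> ~~ (b \subset base_gen F)).
Proof.
move=> gC; rewrite /base_gen; case: pickP => [C1 /andP[gC1 nC1]|none] //.
case: pickP => [C1 gC1|/(_ C)]; last by rewrite gC.
by split=> // nC; have := none C; rewrite gC nC.
Qed.

Lemma degree_solution : exists mu : {set 'I_n} -> K,
  (forall C, ~~ (b \subset C) -> mu C = 0) /\
  (forall F C C', F \in faces_over D a b -> C \in gens_in D b F -> C' \in gens_in D b F ->
     deg_coef F C C' = mu C - mu C').
Proof.
have [nu [nu0 nuE]] : exists nu : {set 'I_n} -> {set 'I_n} -> K,
    (forall F C, F \in faces_over D a b -> C \in gens_in D b F -> ~~ (b \subset C) ->
       nu F C = 0) /\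
    (forall F C C', F \in faces_over D a b -> C \in gens_in D b F ->
       C' \in gens_in D b F -> nu F C - nu F C' = deg_coef F C C').
  exists (fun F C => deg_coef F C (base_gen F)).
  split=> [F C oF gC nC|F C C' oF gC gC']; have [gB nB] := base_genP gC.
    exact: (deg_coef_based oF gC gB nC (nB nC)).
  by rewrite -(deg_coef_add oF gC gC' gB) addrK.
have [|mu [mu0 hmu]] := H1 (a := a) (b := b) (nu := nu).
  split=> [|F G C C' oF oG FG gC gC']; first exact: nu0.
  rewrite (nuE F C C' oF gC gC') (nuE G C C' oG (gens_inS FG gC) (gens_inS FG gC')).
  exact: deg_coef_mono oF oG FG gC gC'.
exists mu; split=> // F C C' oF gC gC'.
by rewrite -(nuE F C C' oF gC gC') (hmu F C C' oF gC gC').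
Qed.

End Degree.

Lemma supp_faces_over m k : mnm_supp k \in D ->
  let e := k +m mnm_ind [set: 'I_n] -m m in (forall i, (m i <= 1)%N) ->
  mnm_supp k \in faces_over D [set i | (1 < e i)%N] [set i | e i == 0%N].
Proof.
move=> kD e m1; apply/faces_overP; split=> //.
  apply/fintype.subsetP => i; have := m1 i; rewrite !inE !mnmS inE /=; clear; lia.
by move=> i; have := m1 i; rewrite !inE !mnmS inE /=; clear; lia.
Qed.

(** The constants of all degrees are the coefficients of the images of the basis vectors. They may
    be cut off at a degree beyond which [f] has no coefficients on the finitely many syzygies at
    lcms, which suffice to compare the two maps. *)
Lemma syz_hom_extends : exists h : {linear free -> Q}, forall s : Syz, f s = h (val s).
Proof.
have [mu hmu] := choice degree_solution.
pose one := mnm_ind [set: 'I_n].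
pose joinm (C C' : A) := mnm_ind (val C :|: val C').
pose size2 (C C' : A) : nat := msize (repr (f (mon_syz (joinm C C') (val C) (val C'))) : S).
(* The extra [n] compensates for the shift of multidegrees by (1, ..., 1). *)
have [d size2_d] : exists d : nat, forall C C' : A, (size2 C C' + n <= d)%N.
  exists (\sum_C \sum_C' size2 C C' + n)%N => C C'.
  rewrite leq_add2r; apply: (@leq_trans (\sum_C1 size2 C C1)).
    by rewrite (bigD1 C') //= leq_addr.
  by rewrite [leqRHS](bigD1 C) //= leq_addr.
pose hc C k : K := if (mdeg (k +m one -m mnm_ind C) < d)%N
  then mu (k +m one -m mnm_ind C) C else 0.
have hcE C k : mcoeff k (mpoly_of d (hc C)) = hc C k.
  rewrite mcoeff_mpoly_of; case: ifPn => // ge; rewrite /hc ifN //.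
  rewrite -!leqNgt in ge *; apply: leq_trans ge _; apply: leq_mdeg.
  by apply/mnm_lepP => i; rewrite !mnmS inE; case: (i \in C) => /=; clear; lia.
have [h hE] := free_hom_exists (fun C : A => \pi_Q%qT (mpoly_of d (hc (val C)) : S^o) : Q).
exists h => s.
have h_unit (C : A) : h (unit_gen (val C)) = \pi_Q%qT (mpoly_of d (hc (val C)) : S^o).
  rewrite hE (bigD1 C) //= ffunE eqxx scale1r big1 ?addr0 // => C' nC.
  have /negPf nC' : val C' != val C by exact: nC.
  by rewrite ffunE nC' scale0r.
pose psi : {linear Syz -> Q} := f \- (h \o val).
suff psi0 : forall C C' : A, psi (mon_syz (joinm C C') (val C) (val C')) = 0.
  by apply/eqP; rewrite -subr_eq0; apply/eqP; exact: (syz_generated psi0 s).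
move=> C C'; set m := joinm C C'; set T := mon_syz m _ _.
have mj i : m i = (i \in val C) || (i \in val C') by rewrite mnm_indE inE.
have leC : mnm_ind (val C) <=m m.
  by apply/mnm_lepP => i; rewrite mj mnm_indE; case: (i \in _).
have leC' : mnm_ind (val C') <=m m.
  by apply/mnm_lepP => i; rewrite mj mnm_indE orbC; case: (i \in _).
have [mC mC'] : min_nonface D (val C) /\ min_nonface D (val C') := conj (valP C) (valP C').
have hT : h (val T) = (X (m -m mnm_ind (val C)) : S) *: h (unit_gen (val C)) -
    (X (m -m mnm_ind (val C')) : S) *: h (unit_gen (val C')).
  by rewrite (mon_syzE mC mC' leC leC') linear_pair.
suff fT : f T = h (val T) by rewrite /psi /= fT subrr.
apply: quot_coef_inj => k kD; rewrite hT quot_coefB // !quot_coefX // !h_unit.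
pose e := k +m one -m m.
have m1 i : (m i <= 1)%N by rewrite mj leq_b1.
have oF : mnm_supp k \in faces_over D [set i | (1 < e i)%N] [set i | e i == 0%N].
  exact: supp_faces_over.
have [mu0 mu_diff] := hmu e.
have term (C1 : A) : mnm_ind (val C1) <=m m ->
    (if m -m mnm_ind (val C1) <=m k then
       quot_coef (k -m (m -m mnm_ind (val C1))) (\pi_Q%qT (mpoly_of d (hc (val C1)) : S^o))
     else 0) = if (mdeg e < d)%N then mu e (val C1) else 0.
  move=> /mnm_lepP lC1; case: ifPn => [/mnm_lepP le|nle].
    rewrite quot_coef_pi; last first.
      apply: simplD kD _; apply/fintype.subsetP => i; rewrite !inE mnmBE.
      by clear; lia.
    rewrite hcE /hc; suff -> : k -m (m -m mnm_ind (val C1)) +m one -m mnm_ind (val C1) = e by [].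
    apply/mnmP => i; have := le i; have := lC1 i; have := m1 i.
    by rewrite /e !mnmBE !mnmDE !mnmBE; clear; lia.
  (* The cofactor fails to divide [k] only if the generator misses a variable of degree -1, and then
     its constant is 0. *)
  rewrite mu0 ?if_same //; apply: contra nle => /fintype.subsetP bC; apply/mnm_lepP => i.
  have := bC i; have := m1 i; have := lC1 i; rewrite inE /e !mnmBE !mnmDE !mnm_indE inE /=.
  by case: (i \in _) => /=; [clear; lia|]; case: eqP => [_ _ _ /(_ isT)//|]; clear; lia.
rewrite (term C leC) (term C' leC'); case: ifPn => [lt|ge].
  have gens (C1 : A) : (forall i, i \in val C1 -> m i = 1%N) ->
      val C1 \in gens_in D [set i | e i == 0%N] (mnm_supp k).
    move=> h1; apply/gens_inP; split; first exact: (valP C1).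
    apply/fintype.subsetP => i /h1 mi; rewrite !inE /e !mnmBE !mnmDE mnm_indE inE mi /=.
    by clear; lia.
  have gC : val C \in gens_in D [set i | e i == 0%N] (mnm_supp k).
    by apply: gens => i iC; rewrite mj iC.
  have gC' : val C' \in gens_in D [set i | e i == 0%N] (mnm_supp k).
    by apply: gens => i iC; rewrite mj iC orbT.
  rewrite -(mu_diff _ _ _ oF gC gC').
  rewrite /deg_coef; set U := mnm_ind (_ :|: _).
  have Ui i : U i = (k i != 0%N) || (e i == 0%N) :> nat by rewrite mnm_indE !inE.
  (* Multiplication by x^p moves the lcm [m] to the full exponent of F and b without changing the
     coefficient. *)
  pose p := U -m m.
  have ei i : e i = (k i + 1 - m i)%N by rewrite /e !mnmBE !mnmDE mnm_indE inE.
  have eU : U = m +m p.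
    apply/mnmP => i; rewrite mnmDE mnmBE Ui; have := ei i; have := m1 i.
    by case: (e i == 0%N) / eqP; case: (k i == 0%N) / eqP => /=; clear; lia.
  have eT : U +m e -m mnm_ind [set: 'I_n] = k +m p.
    apply/mnmP => i.
    have -> : (U +m e -m mnm_ind [set: 'I_n]) i = (U i + e i - 1)%N.
      by rewrite mnmBE mnmDE mnm_indE inE.
    have -> : (k +m p) i = (k i + (U i - m i))%N by rewrite mnmDE mnmBE.
    rewrite Ui; have := ei i; have := m1 i.
    by case: (e i == 0%N) / eqP; case: (k i == 0%N) / eqP => /=; clear; lia.
  rewrite eT [in RHS]eU pair_coef_shift // -eT.
  by rewrite (tgt_supp oF).
(* Beyond the cutoff both constants are replaced by 0, and [f] has no coefficient there either. *)
suff hd : (size2 C C' <= mdeg k)%N by rewrite subrr /quot_coef (mcoeff_big_degree hd).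
have : (mdeg e <= mdeg k + mdeg one)%N.
  by rewrite -mdegD; apply: leq_mdeg; apply: lem_subr.
have := mdeg_ind [set: 'I_n]; rewrite -/one; move: ge (size2_d C C'); rewrite -leqNgt.
by clear; lia.
Qed.

End Solve.

Theorem T2_vanishesP : T2_vanishes K D <-> forall a b, H1_trivial D K a b.
Proof.
split; first exact: T2_vanishes_H1.
move=> H1; apply: (T2_trivialP (@mingen_SR_ideal K n D)).2 => f fK.
exact: syz_hom_extends H1 f fK.
Qed.

End Ideal.
End Algebra.

Lemma deletion_simplicial n (D : {set {set 'I_n}}) (W : {set 'I_n}) :
  simplicial_complex D -> simplicial_complex (deletion D W).
Proof.
move=> simplD F G; rewrite !inE => /andP[FD FW] GF.
by rewrite (simplD F) //= (disjointWl GF).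
Qed.

Local Close Scope ring_scope.

Theorem theorem3p2 (K : fieldType) (R : realType) (n : nat)
    (D : {set {set 'I_n}}) :
  0 < n ->
  simplicial_complex D ->
  (forall v : 'I_n, [set v] \in D) ->
  one_dimensional D ->
  T2_vanishes K D <->
  [/\ forall v : 'I_n, [set v] \in D -> local_degree D v <= 3,
      forall s : seq 'I_n, is_cycle D s -> dominating D [set v in s]
    & forall b : {set 'I_n}, min_nonface D b -> #|b| = 2 ->
        complex_connected R (deletion D (hat D b))].
Proof.
move=> _ simplD vertD dimD.
apply: (iff_trans (T2_vanishesP K simplD)).
apply: (iff_trans (H1_iff simplD vertD dimD K)).
have conn b := complex_graph_connected R (deletion_simplicial (W := hat D b) simplD).
split=> -[degD cycD conD]; split=> //.
- by move=> b mb cb; apply/conn/conD.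
- by move=> v; apply: degD.
- by move=> b mb cb; apply/conn/conD.
Qed.
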